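(* Let $(G_{k,k-1},G_{k,N},G_k)$, $k\in[1,N-1]$, be the parameters of a reciprocal $CM_L$ model $$x_k=G_{k,k-1}x_{k-1}+G_{k,N}x_N+e_k,\quad k\in[1,N-1].$$ Then the set of reciprocal sequences modeled by this reciprocal $CM_L$ model includes Markov sequences; that is, there exist a matrix $G_{0,N}$ and positive definite matrices $G_0,G_N$ such that the zero-mean nonsingular Gaussian sequence $[x_k]$ governed by $x_k=G_{k,k-1}x_{k-1}+G_{k,N}x_N+e_k$, $k\in[1,N-1]$, together with the boundary condition $x_N=e_N$, $x_0=G_{0,N}x_N+e_0$, where $[e_k]$ is a zero-mean white nonsingular Gaussian sequence with $\mathrm{Cov}(e_k)=G_k$, $k\in[0,N]$, is Markov.
   Context: $N$ is a positive integer and $[i,j]=\{i,i+1,\ldots,j\}$ (empty if $i>j$); $[x_k]$ denotes $(x_k)_{k\in[0,N]}$, with $x_k$ valued in $\mathbb{R}^d$. The prime denotes matrix transposition. A sequence is nonsingular Gaussian if the stacked vector of all its terms is jointly Gaussian with nonsingular covariance matrix. A zero-mean white nonsingular Gaussian sequence $[e_k]$ is a jointly Gaussian, zero-mean sequence whose terms are mutually uncorrelated, with each $\mathrm{Cov}(e_k)$ nonsingular. A sequence is Markov if, conditioned on the state at any time $k$, the segment before $k$ is independent of the segment after $k$. A sequence is reciprocal if, conditioned on the states at any two times $j<l$, the segment inside $(j,l)$ is independent of the two segments outside $[j,l]$. A $CM_L$ model is the equation $x_k=G_{k,k-1}x_{k-1}+G_{k,N}x_N+e_k$, $k\in[1,N-1]$,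 with $d\times d$ matrices $G_{k,k-1},G_{k,N}$ and positive definite $G_k=\mathrm{Cov}(e_k)$, considered without its boundary condition $x_N=e_N$, $x_0=G_{0,N}x_N+e_0$ (whose parameters are $G_{0,N}$, $G_0=\mathrm{Cov}(e_0)$, $G_N=\mathrm{Cov}(e_N)$). It is a reciprocal $CM_L$ model if its parameters satisfy $G_k^{-1}G_{k,N}=G_{k+1,k}'G_{k+1}^{-1}G_{k+1,N}$ for all $k\in[1,N-2]$; a known result is that this is equivalent to the zero-mean nonsingular Gaussian sequence governed by the model and the boundary condition being reciprocal (whatever the boundary parameters). *)

(* Defs.v *)
From HB Require Import structures.
From mathcomp Require Import all_boot all_order all_algebra.
From mathcomp Require Import all_classical all_reals all_analysis.

Set Implicit Arguments.
Unset Strict Implicit.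
Unset Printing Implicit Defensive.

Import Order.TTheory GRing.Theory Num.Theory.
Import numFieldNormedType.Exports.

Local Open Scope classical_set_scope.
Local Open Scope ring_scope.

Definition posdefmx (R : realType) (n : nat) (A : 'M[R]_n) : Prop :=
  A^T = A /\ forall v : 'cV[R]_n, v != 0 -> 0 < (v^T *m A *m v) 0 0.

Section RandomVectors.
Context (disp : measure_display) (T : measurableType disp) (R : realType).
Variable P : probability T R.

(* The degenerate case is separate because [normal_prob m 0] is not the Dirac
   mass at [m]. *)
Definition gaussian_rv (X : T -> R) : Prop :=
  measurable_fun setT X /\
  exists m s : R, 0 <= s /\
    forall B : set R, measurable B ->
      P (X @^-1` B) = (if s == 0%R then \d_m B else normal_prob m s B).

Definition jointly_gaussian (n : nat) (X : T -> 'cV[R]_n) : Prop :=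
  forall c : 'rV[R]_n, gaussian_rv (fun w => (c *m X w) 0 0).

Definition zero_mean (n : nat) (X : T -> 'cV[R]_n) : Prop :=
  forall i, ('E_P[fun w => X w i 0%R] = 0)%E.

(* [fine] loses nothing on the square integrable vectors considered below. *)
Definition covmx (m n : nat) (X : T -> 'cV[R]_m) (Y : T -> 'cV[R]_n) :
    'M[R]_(m, n) :=
  \matrix_(i, j) fine (covariance P (fun w => X w i 0) (fun w => Y w j 0)).

(* The sequence [x_k], k in [0, N], is a function on nat of which only the
   values at k <= N are used. *)
Section Sequences.
Variables (d N : nat).
Implicit Types x e : nat -> T -> 'cV[R]_d.

Definition stack x : T -> 'cV[R]_(\sum_(k < N.+1) d) :=
  fun w => \mxcol_(k < N.+1) x k w.

Definition zm_nonsingular_gaussian x : Prop :=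
  [/\ jointly_gaussian (stack x),
      forall k, (k <= N)%N -> zero_mean (x k)
    & covmx (stack x) (stack x) \in unitmx].

Definition zm_white_nonsingular_gaussian e : Prop :=
  [/\ jointly_gaussian (stack e),
      forall k, (k <= N)%N -> zero_mean (e k),
      forall j k, (j <= N)%N -> (k <= N)%N -> j != k ->
        covmx (e j) (e k) = 0
    & forall k, (k <= N)%N -> covmx (e k) (e k) \in unitmx].

Definition sigma_seq x (J : set nat) : set (set T) :=
  <<s \bigcup_(k in J) \bigcup_(i in [set: 'I_d])
        preimage_set_system setT (fun w => x k w i 0)
          (measurable : set (set R)) >>.

End Sequences.

(* [f] is a version of the conditional probability P(A | F). *)
Definition cond_prob_version (F : set (set T)) (A : set T) (f : T -> R) :
    Prop :=
  [/\ forall B : set R, measurable B -> F (f @^-1` B),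
      P.-integrable setT (EFin \o f)
    & forall C, F C -> (\int[P]_(w in C) (f w)%:E)%E = P (A `&` C)].

(* P(A `&` B | H) = P(A | H) P(B | H) almost surely, for all A in F and
   B in G; since versions are almost surely unique, it does not matter which
   ones are taken. *)
Definition cond_indep (F G H : set (set T)) : Prop :=
  forall A B, F A -> G B -> exists f g : T -> R,
    [/\ cond_prob_version H A f, cond_prob_version H B g
      & cond_prob_version H (A `&` B) (f \* g)].

Definition markov_seq (d N : nat) (x : nat -> T -> 'cV[R]_d) : Prop :=
  forall k, (k <= N)%N ->
    cond_indep (sigma_seq x [set j | (j < k)%N])
               (sigma_seq x [set j | (k < j <= N)%N])
               (sigma_seq x [set k]).

End RandomVectors.

(* [Gp k], [Gl k], [G k] stand for G_{k,k-1}, G_{k,N}, G_k; only the indices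
   k in [1, N-1] matter. *)
Definition CML_model (R : realType) (d N : nat) (Gp Gl G : nat -> 'M[R]_d) :
    Prop :=
  forall k, (1 <= k < N)%N -> posdefmx (G k).

Definition reciprocal_CML_model (R : realType) (d N : nat)
    (Gp Gl G : nat -> 'M[R]_d) : Prop :=
  CML_model N Gp Gl G /\
  forall k, (1 <= k)%N -> (k.+1 < N)%N ->
    invmx (G k) *m Gl k = (Gp k.+1)^T *m invmx (G k.+1) *m Gl k.+1.

Definition noise_cov (R : realType) (d N : nat) (G : nat -> 'M[R]_d)
    (G0 GN : 'M[R]_d) (k : nat) : 'M[R]_d :=
  if k == 0%N then G0 else if k == N then GN else G k.

Definition CML_governed (disp : measure_display) (T : measurableType disp)
    (R : realType) (P : probability T R) (d N : nat)
    (Gp Gl G : nat -> 'M[R]_d) (G0N G0 GN : 'M[R]_d)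
    (x : nat -> T -> 'cV[R]_d) : Prop :=
  exists e : nat -> T -> 'cV[R]_d,
    [/\ zm_white_nonsingular_gaussian P N e,
        forall k, (k <= N)%N -> covmx P (e k) (e k) = noise_cov N G G0 GN k,
        forall k w, (1 <= k < N)%N ->
          x k w = Gp k *m x k.-1 w + Gl k *m x N w + e k w,
        forall w, x N w = e N w
      & forall w, x 0%N w = G0N *m x N w + e 0%N w].

(* Main.v *)
(**
With [G0 = GN = 1] and [G0N = G_{1,0}' G_1^-1 G_{1,N}], the reciprocity
condition says exactly that the terms coupling [x_k] and [x_N], [k < N - 1], in
the quadratic form
[sum_k |x_k - G_{k,k-1} x_{k-1} - G_{k,N} x_N|^2_{G_k^-1} + |x_0 - G0N x_N|^2 + |x_N|^2]
cancel, so that the precision matrix [K] of the stacked vector is block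
tridiagonal.  Put [Y = K x]: the blocks of [Y] before time [k], those after [k],
and [x_k] are pairwise uncorrelated, hence independent, and the past (future) is
a linear function of the past (future) blocks of [Y] and of [x_k].

That uncorrelated jointly Gaussian vectors are independent follows from the
functional equation of the characteristic function, i.e. from the rotation
invariance of the product of two standard normal laws: it gives
[E(f g) = E f * E g] for trigonometric polynomials [f], [g] of the two vectors,
and indicators of orthants are limits of such polynomials.
*)
Require Import Defs.
From HB Require Import structures.
From mathcomp Require Import all_boot all_order all_algebra.
From mathcomp Require Import all_classical all_reals all_analysis.
From mathcomp Require Import ring lra measurable_realfun.
Set Implicit Arguments.
Unset Strict Implicit.
Unset Printing Implicit Defensive.

Import Order.TTheory GRing.Theory Num.Theory.
Import numFieldNormedType.Exports.

Local Open Scope classical_set_scope.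
Local Open Scope ring_scope.

(** * The standard normal law *)

Section GaussianMeasure.
Context {R : realType}.
Local Notation mu := (@lebesgue_measure R).

(** The reciprocity condition ties together only the interior parameters. The coupling of $x_0$ with
    $x_N$ also involves the boundary, and the free choice of $G_{0,N}$ is exactly what cancels it;
    $G_N$ enters only the last diagonal block of [K], so it does not affect the band structure.
    Conditional probabilities exist only as versions, so independence of the three Gaussian blocks
    has to be made concrete. An event of the past is a set in the pair ($x_k$, block of [Y]);
    freezing $x_k$ and measuring the section gives an everywhere defined version. A past section and
    a future section form a rectangle, whose product measure factors. This is why the past is first
    re-expressed through [Y]: sections can be integrated this way only in independent variables.
    Recovering the past from [Y] means inverting a diagonal compression of [K], which positive
    definiteness allows. Joint Gaussianity is given only through linear forms, so vectors are
    handled through the laws of their forms, with no multivariate density. *)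

Definition stdgauss : probability (measurableTypeR R) R := normal_prob 0 1.

(** Closed upper rays are stable under intersection, generate the Borel sets, and exhaust the line
    along the negative integers. *)
Lemma measure_unique_rays (m1 m2 : probability (measurableTypeR R) R) :
  (forall x, m1 `[x, +oo[%classic = m2 `[x, +oo[%classic) ->
  forall A, measurable A -> m1 A = m2 A.
Proof.
move=> m12 A mA.
apply: (measure_unique (T := measurableTypeR R) (@RGenCInfty.G R)
  (fun n => `[- n%:R, +oo[%classic) _ _ _ _ m1 m2) => //.
- exact: RGenCInfty.measurableE.
- move=> _ _ [x ->] [y ->]; exists (Num.max x y).
  by apply/seteqP; split => z /=; rewrite !in_itv/= !andbT ge_max => /andP.
- by move=> i; exists (- i%:R).
- rewrite -subTset => x _; exists (Num.truncn `|x|).+1 => //=.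
  rewrite in_itv/= andbT lerNl (le_trans (ler_norm _))// normrN ltW//.
  exact: truncnS_gt.
- by move=> _ [x ->]; exact: m12.
- by move=> k; rewrite -ge0_fin_numE// fin_num_measure.
Qed.

Lemma normal_pdf_peakE (m s x : R) : s != 0 ->
  normal_pdf m s x = normal_peak s * normal_fun m s x.
Proof. by move=> /negbTE s0; rewrite /normal_pdf s0. Qed.

Lemma gauss_image_unique (F : R -> R) (m : probability (measurableTypeR R) R) :
  measurable_fun [set: R] F ->
  (forall x, m `[x, +oo[%classic = stdgauss (F @^-1` `[x, +oo[%classic)) ->
  forall A, measurable A -> m A = stdgauss (F @^-1` A).
Proof.
move=> mF mE A mA.
pose G : {mfun measurableTypeR R >-> measurableTypeR R} :=
  HB.pack (F : measurableTypeR R -> measurableTypeR R)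
    (isMeasurableFun.Build _ _ (measurableTypeR R) (measurableTypeR R) F mF).
have mGE x : m `[x, +oo[%classic = distribution stdgauss G `[x, +oo[%classic.
  exact: mE.
exact: (measure_unique_rays mGE mA).
Qed.

(** On a ray this is the substitution of [m + s * z] in the density integral; the Jacobian [s] is
    absorbed by the normalizing constant. *)
Lemma normal_prob_affine (m s : R) : 0 < s -> forall A, measurable A ->
  normal_prob m s A = stdgauss ((fun z => m + s * z) @^-1` A).
Proof.
move=> s0; apply: gauss_image_unique.
  by apply: measurable_funD => //; exact: measurable_funM.
move=> x; pose F (z : R) := m + s * z; pose a := (x - m) / s.
have Fa : m + s * a = x by rewrite /a mulrC divfK ?gt_eqF// addrC subrK.
rewrite (_ : _ @^-1` _ = `[a, +oo[%classic); last first.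
  by apply/seteqP; split => z; rewrite /= !in_itv/= !andbT -Fa lerD2l ler_pM2l.
rewrite /stdgauss /normal_prob.
have dF z : is_derive z (1 : R) F s.
  by apply: is_derive_eq; rewrite add0r mul1r /GRing.scale/= mulr1.
have F'E : F^`()%classic = cst s.
  by apply/funext => z; rewrite derive1E derive_val.
transitivity (\int[mu]_(z in `[F a, +oo[) (normal_pdf m s z)%:E)%E.
  by rewrite /F Fa.
rewrite (@increasing_ge0_integration_by_substitutiony _ F
  (normal_pdf m s) a).
- apply: eq_integral => z _ /=; congr EFin.
  rewrite F'E -[LHS]/(normal_pdf m s (F z) * s) !normal_pdf_peakE ?gt_eqF//
    mulrAC /normal_peak /normal_fun; congr (_ * expR _).
    rewrite expr1n mul1r -mulrnAr sqrtrM ?sqr_ge0// sqrtr_sqr gtr0_norm//.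
    by rewrite invfM mulrAC mulVf ?mul1r ?gt_eqF.
  rewrite /F; field; lra.
- by move=> y z _ _ yz; rewrite ltrD2l ltr_pM2l.
- by move=> z _; rewrite F'E; exact: cvg_cst.
- by rewrite F'E; exact: is_cvg_cst.
- by rewrite F'E; exact: is_cvg_cst.
- split=> [z _|]; first exact: ex_derive.
  apply: cvg_at_right_filter.
  exact/differentiable_continuous/derivable1_diffP/(@ex_derive _ _ _ _ _ _ _
    (dF a)).
- apply/cvgryPge => A; near=> z.
  rewrite -lerBlDl mulrC -ler_pdivrMr//; near: z; exact: nbhs_pinfty_ge.
- apply: continuous_subspaceT; apply: continuous_normal_pdf; by rewrite gt_eqF.
- by move=> z _; exact: normal_pdf_ge0.
Unshelve. all: by end_near. Qed.

Lemma stdgauss_sym A : measurable A -> stdgauss A = stdgauss (-%R @^-1` A).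
Proof.
apply: gauss_image_unique => // x.
rewrite (_ : _ @^-1` _ = `]-oo, - x]%classic); last first.
  by apply/seteqP; split => z; rewrite /= !in_itv/= ?andbT lerNr.
rewrite /stdgauss /= /normal_prob ge0_integration_by_substitutionNy.
- apply: eq_integral => z _ /=.
  by rewrite !normal_pdf_peakE ?oner_eq0// /normal_fun !subr0 sqrrN.
- by apply: continuous_subspaceT; exact: continuous_normal_pdf.
- by move=> z _; exact: normal_pdf_ge0.
Qed.

End GaussianMeasure.

(** * Integrals determined by the law of a random variable *)

Section Law.
Context {R : realType}.
Local Open Scope ereal_scope.

(** The integral is the difference of those of the positive and negative parts, and each of these is
    an integral against the image law. *)
Lemma same_law_integral d1 (T1 : measurableType d1) (P1 : probability T1 R)
    d2 (T2 : measurableType d2) (P2 : probability T2 R)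
    (X : T1 -> R) (Y : T2 -> R) (f : R -> \bar R) :
  measurable_fun setT X -> measurable_fun setT Y -> measurable_fun setT f ->
  (forall A, measurable A -> P1 (X @^-1` A) = P2 (Y @^-1` A)) ->
  \int[P1]_w f (X w) = \int[P2]_w f (Y w).
Proof.
move=> mX mY mf XY.
suff ge0 (g : R -> \bar R) : measurable_fun setT g -> (forall x, 0 <= g x) ->
    \int[P1]_w g (X w) = \int[P2]_w g (Y w).
  rewrite [LHS]integralE [RHS]integralE; congr (_ - _).
    rewrite (funepos_comp f X) (funepos_comp f Y).
    exact: (ge0 f^\+ (measurable_funepos mf) (funepos_ge0 f)).
  rewrite (funeneg_comp f X) (funeneg_comp f Y).
  exact: (ge0 f^\- (measurable_funeneg mf) (funeneg_ge0 f)).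
move=> mg g0.
pose X' : {mfun T1 >-> R} := HB.pack X (isMeasurableFun.Build _ _ _ _ X mX).
pose Y' : {mfun T2 >-> R} := HB.pack Y (isMeasurableFun.Build _ _ _ _ Y mY).
rewrite -[LHS]/(\int[P1]_w (g \o X') w) -[RHS]/(\int[P2]_w (g \o Y') w).
rewrite -!ge0_integral_distribution//.
by apply: eq_measure_integral => A mA _; exact: XY.
Qed.

Lemma bounded_integrable d (T : measurableType d) (P : probability T R)
    (f : T -> R) (M : R) :
  measurable_fun setT f -> (forall w, `|f w| <= M)%R ->
  P.-integrable setT (EFin \o f).
Proof.
move=> mf fM; apply: measurable_bounded_integrable => //.
  by rewrite (le_lt_trans (probability_le1 _ _)) ?ltry.
exists M; split; first by rewrite num_real.
by move=> N MN w _ /=; exact: le_trans (fM w) (ltW MN).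
Qed.

End Law.

(** * Second moment of the standard normal law *)

Section GaussianMoments.
Context {R : realType}.
Local Notation mu := (@lebesgue_measure R).
Local Open Scope ereal_scope.

(** The Radon-Nikodym derivative of [normal_prob] and the explicit density have the same integral
    over every measurable set, hence agree almost everywhere. *)
Lemma ge0_integral_normal_prob (m s : R) (f : R -> \bar R) :
  measurable_fun setT f -> (forall x, 0 <= f x) ->
  \int[normal_prob m s]_x f x = \int[mu]_x (f x * (normal_pdf m s x)%:E).
Proof.
move=> mf f0; have dom := @normal_prob_dominates R m s.
rewrite -(Radon_Nikodym_SigmaFinite.change_of_variables dom)//=.
have h1 := Radon_Nikodym_SigmaFinite.f_integrable dom.
apply: ae_eq_integral => //.
- by apply: emeasurable_funM => //; exact: measurable_int h1.
- apply: emeasurable_funM => //; apply/measurable_EFinP;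
    exact: measurable_normal_pdf.
- apply: ae_eqe_mul2l => /=.
  apply: integral_ae_eq => //=.
  + by apply/measurable_EFinP; exact: measurable_normal_pdf.
  + move=> E _ mE; rewrite -Radon_Nikodym_SigmaFinite.f_integral//.
Qed.

Lemma normal_peakE (s : R) : (0 < s)%R -> normal_peak s = (s^-1 * normal_peak 1)%R.
Proof.
move=> s0; rewrite /normal_peak expr1n mul1r -mulrnAr sqrtrM ?sqr_ge0//.
by rewrite sqrtr_sqr gtr0_norm// invfM.
Qed.

(** Domination by a wider normal density, of variance 2: the inequality $x^2/4 \le e^{x^2/4}$ gives
    $x^2 e^{-x^2/2} \le 4 e^{-x^2/4}$, and the factor [s] compensates for the ratio of the two
    peaks. *)
Lemma integrable_stdgauss_sqr :
  (@stdgauss R).-integrable setT (fun z => (z ^+ 2)%:E).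
Proof.
apply/integrableP; split; first by apply/measurable_EFinP; exact: measurable_funX.
under eq_integral do rewrite /= ger0_norm ?sqr_ge0//.
rewrite ge0_integral_normal_prob; first last.
- by move=> x; rewrite lee_fin sqr_ge0.
- by apply/measurable_EFinP; exact: measurable_funX.
pose s := Num.sqrt 2 : R.
have s0 : (0 < s)%R by rewrite sqrtr_gt0.
apply: (@le_lt_trans _ _ (\int[mu]_x ((4 * s)%:E * (normal_pdf 0 s x)%:E))).
  apply: ge0_le_integral => //.
  - by move=> x _; rewrite -EFinM lee_fin mulr_ge0 ?sqr_ge0 ?normal_pdf_ge0.
  - apply/measurable_EFinP; apply: measurable_funM; first exact: measurable_funX.
    exact: measurable_normal_pdf.
  - apply/measurable_EFinP; apply: measurable_funM => //.
    exact: measurable_normal_pdf.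
  - move=> x _; rewrite -!EFinM lee_fin !normal_pdf_peakE ?oner_eq0 ?gt_eqF//.
    rewrite (normal_peakE s0) mulrCA [leRHS]mulrA
      [leRHS](_ : _ = normal_peak 1 * (4 * normal_fun 0 s x))%R; last first.
      by field; rewrite gt_eqF.
    rewrite ler_wpM2l ?normal_peak_ge0// /normal_fun !subr0 expr1n sqr_sqrtr//.
    have -> : (- x ^+ 2 / (1 *+ 2) = - x ^+ 2 / (2 *+ 2) + - x ^+
      2 / (2 *+ 2))%R by field.
    rewrite expRD mulrA ler_wpM2r ?expR_ge0//.
    rewrite mulNr expRN ler_pdivrMr ?expR_gt0//.
    have := expR_ge1Dx (x ^+ 2 / (2 *+ 2)); lra.
rewrite integralZl//; last exact: integrable_normal_pdf.
by rewrite integral_normal_pdf mule1 ltry.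
Qed.

(* Its value is 1, but only its positivity is needed. *)
Definition stdvar : R := fine (\int[stdgauss]_z (z ^+ 2)%:E).

Lemma stdvarE : \int[@stdgauss R]_z (z ^+ 2)%:E = stdvar%:E.
Proof. by rewrite fineK// integrable_fin_num//; exact: integrable_stdgauss_sqr. Qed.

(** A vanishing second moment would concentrate the law at 0, but a point is Lebesgue-null and the
    normal law is absolutely continuous. *)
Lemma stdvar_gt0 : (0 < stdvar)%R.
Proof.
rewrite lt_neqAle andbC -lee_fin -stdvarE integral_ge0 /=; last first.
  by move=> x _; rewrite lee_fin sqr_ge0.
apply/negP => /eqP v0.
have : ae_eq (@stdgauss R) setT (fun z => (z ^+ 2)%:E) (cst 0).
  apply/ae_eq_integral_abs => //.
    by apply/measurable_EFinP; exact: measurable_funX.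
  under eq_integral do rewrite /= ger0_norm ?sqr_ge0//.
  by rewrite stdvarE -v0.
move=> [N [mN N0 sub]].
have : stdgauss [set~ (0 : measurableTypeR R)%R] <= 0.
  rewrite -N0 le_measure ?inE//; first exact: measurableC.
  by apply: subset_trans sub => z /= /eqP z0 /(_ I) [] /eqP;
    rewrite sqrf_eq0 (negbTE z0).
rewrite probability_setC//.
have -> : stdgauss [set (0 : measurableTypeR R)%R] = 0.
  apply: (null_content_dominatesP _ _).1 (@normal_prob_dominates R 0 1) _ _ _ => //.
  exact: lebesgue_measure_set1.
by rewrite sube0 leNgt lte01.
Qed.

End GaussianMoments.

(** * Rotation invariance of the standard normal law *)

Section GaussianSum.
Context {R : realType}.
Local Notation mu := (@lebesgue_measure R).
Local Notation gauss := (@stdgauss R).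
Local Open Scope ereal_scope.

Lemma measurable_scale_preimage (s : R) (A : set R) :
  measurable A -> measurable ((fun z : R => s * z)%R @^-1` A).
Proof.
move=> mA; rewrite -[X in measurable X]setTI.
have : measurable_fun setT (fun z : R => s * z)%R by exact: measurable_funM.
exact.
Qed.

Lemma stdgauss_scale_norm (s : R) (A : set R) : measurable A ->
  gauss ((fun z => `|s| * z)%R @^-1` A) = gauss ((fun z => s * z)%R @^-1` A).
Proof.
move=> mA; have [s0|s0] := leP 0%R s; first by rewrite ger0_norm.
rewrite ltr0_norm// [RHS]stdgauss_sym; last exact: measurable_scale_preimage.
by congr (gauss _); apply/seteqP; split => z /=; rewrite mulrN mulNr.
Qed.

(** Completing the square. For independent standard normal [X], [Y], both sides are the joint
    density of [X] and [a X + b Y]: law of [X] times conditional law of the sum on the left, law of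
    the sum times conditional law of [X] on the right. *)
Lemma normal_pdf_convE (a b z x : R) : (0 < b)%R ->
  let c := Num.sqrt (a ^+ 2 + b ^+ 2) in
  (normal_pdf (a * x) b z * normal_pdf 0 1 x =
   normal_pdf 0 c z * normal_pdf (a * z / c ^+ 2) (b / c) x)%R.
Proof.
move=> b0 c; have c2 : (c ^+ 2 = a ^+ 2 + b ^+ 2)%R.
  by rewrite sqr_sqrtr// addr_ge0 ?sqr_ge0.
have c0 : (0 < c)%R by rewrite sqrtr_gt0 ltr_wpDl ?sqr_ge0// exprn_gt0.
have bc0 : (0 < b / c)%R by rewrite divr_gt0.
rewrite !normal_pdf_peakE ?oner_eq0 ?gt_eqF//.
rewrite (normal_peakE b0) (normal_peakE c0) (normal_peakE bc0).
rewrite mulrACA [RHS]mulrACA /normal_fun -!expRD; congr (_ * expR _)%R.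
  by field; rewrite !gt_eqF.
rewrite (_ : (b / c) ^+ 2 = b ^+ 2 / c ^+ 2)%R ?expr_div_n//.
rewrite (_ : (c ^+ 2 *+ 2 = (a ^+ 2 + b ^+ 2) *+ 2)%R) ?c2//.
field; rewrite -c2 !gt_eqF ?exprn_gt0//.
Qed.

(** By Tonelli, the factorization [normal_pdf_convE] lets [x] be integrated out first: its
    conditional density has mass 1, which leaves the normal density of standard deviation [c]. *)
Lemma stdgauss_conv (a b : R) (A : set R) : measurable A ->
  (gauss \x gauss) ((fun p => a * p.1 + b * p.2)%R @^-1` A) =
  gauss ((fun z => Num.sqrt (a ^+ 2 + b ^+ 2) * z)%R @^-1` A).
Proof.
move=> mA; rewrite /product_measure1.
(* At [b = 0] the conditional law of the sum has no density, and the statement is plain scaling by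
   [a]. *)
have [->|b0] := eqVneq b 0%R.
  rewrite expr0n addr0 sqrtr_sqr stdgauss_scale_norm//.
  transitivity (\int[gauss]_x (\1_((fun z : R => a * z)%R @^-1` A) x)%:E);
    last first.
    by rewrite integral_indic ?setIT//; exact: measurable_scale_preimage.
  apply: eq_integral => x _ /=; rewrite indicE /=.
  rewrite (_ : xsection _ x = [set _ | A (a * x)%R]); last first.
    by apply/seteqP; split => y /=; rewrite /xsection /= inE /= mul0r addr0.
  have [Ax|Ax] := boolP ((x : R) \in (fun z : R => a * z)%R @^-1` A).
    rewrite inE in Ax; rewrite (_ : [set _ | _] = setT) ?probability_setT//.
    by apply/seteqP; split.
  rewrite notin_setE in Ax; rewrite (_ : [set _ | _] = set0) ?measure0//.
  by apply/seteqP; split.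
pose beta := `|b|%R; have beta0 : (0 < beta)%R by rewrite normr_gt0.
rewrite -(real_normK (num_real b)) -/beta.
pose c := Num.sqrt (a ^+ 2 + beta ^+ 2).
have c0 : (0 < c)%R by rewrite sqrtr_gt0 ltr_wpDl ?sqr_ge0// exprn_gt0.
have mpdf : measurable_fun setT
    (fun p : R * R => (normal_pdf (a * p.1) beta p.2 * normal_pdf 0 1 p.1)%:E).
  apply/measurable_EFinP; apply: measurable_funM; last first.
    by apply: measurableT_comp => //; exact: measurable_normal_pdf.
  apply: (eq_measurable_fun (fun p : R * R => normal_peak beta *
      expR (- (p.2 - a * p.1) ^+ 2 / (beta ^+ 2 *+ 2)))%R).
    by move=> p _; rewrite normal_pdf_peakE ?gt_eqF.
  apply: measurable_funM => //; apply: measurableT_comp => //.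
  apply: measurable_funM => //; apply: measurableT_comp => //.
  apply: measurable_funX; apply: measurable_funB => //.
  exact: measurable_funM.
have sec x : gauss (xsection ((fun p => a * p.1 + b * p.2)%R @^-1` A) x) =
    \int[mu]_(z in A) (normal_pdf (a * x) beta z)%:E.
  rewrite -/(normal_prob (a * x) beta A) normal_prob_affine//.
  have -> : xsection ((fun p => a * p.1 + b * p.2)%R @^-1` A) x =
     (fun y => b * y)%R @^-1` ((fun z => a * x + z)%R @^-1` A).
    by apply/seteqP; split => y /=; rewrite /xsection /= inE.
  rewrite -stdgauss_scale_norm//.
  rewrite -[X in measurable X]setTI.
  have : measurable_fun setT (fun z : R => a * x + z)%R by exact: measurable_funD.
  exact.
have mS : measurable ((fun p : R * R => a * p.1 + b * p.2)%R @^-1` A).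
  rewrite -[X in measurable X]setTI.
  suff : measurable_fun setT (fun p : R * R => a * p.1 + b * p.2)%R by exact.
  by apply: measurable_funD; exact: measurable_funM.
rewrite ge0_integral_normal_prob //; last exact: measurable_fun_xsection.
under eq_integral => x _ do rewrite /= sec.
pose q (p : R * R) :=
  (normal_pdf (a * p.1) beta p.2 * normal_pdf 0 1 p.1)%:E * (\1_A p.2)%:E.
have mq : measurable_fun setT q.
  apply: emeasurable_funM => //; apply/measurable_EFinP.
  by apply: measurableT_comp => //; exact: measurable_indic.
have q0 p : 0 <= q p.
  by rewrite /q -EFinM lee_fin !mulr_ge0 ?normal_pdf_ge0// indicE.
transitivity (\int[mu]_x \int[mu]_z q (x, z)).
  apply: eq_integral => x _.
  rewrite -ge0_integralZr//; first last.
  - by rewrite lee_fin normal_pdf_ge0.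
  - by move=> z _; rewrite lee_fin normal_pdf_ge0.
  - by apply/measurable_funTS/measurable_EFinP; exact: measurable_normal_pdf.
  rewrite integral_mkcond epatch_indic; apply: eq_integral => z _.
  by rewrite /q /= EFinM.
rewrite fubini_tonelli//.
rewrite (_ : _ @^-1` A = (fun z => 0 + c * z)%R @^-1` A); last first.
  by apply/seteqP; split => z /=; rewrite add0r.
rewrite -normal_prob_affine// /normal_prob [RHS]integral_mkcond epatch_indic.
apply: eq_integral => z _ /=.
under eq_integral => x _ do rewrite /q /= normal_pdf_convE// -/c EFinM muleAC.
rewrite ge0_integralZl//; first last.
- by rewrite -EFinM lee_fin mulr_ge0// ?normal_pdf_ge0// indicE.
- by move=> x _; rewrite lee_fin normal_pdf_ge0.
- by apply/measurable_EFinP; exact: measurable_normal_pdf.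
by rewrite integral_normal_pdf mule1.
Qed.

End GaussianSum.

(** * Characteristic function of the standard normal law *)

Section GaussianCos.
Context {R : realType}.
Local Notation gauss := (@stdgauss R).
Local Open Scope ereal_scope.

(* The characteristic function of the standard normal law; only its functional
   equation [gauss_cos_sqrt] is needed. *)
Definition gauss_cos (s : R) : R := fine (\int[gauss]_z (cos (s * z))%:E).

Lemma measurable_cos : measurable_fun [set: R] (@cos R).
Proof. by apply: continuous_measurable_fun => x; exact: continuous_cos. Qed.

Lemma measurable_sin : measurable_fun [set: R] (@sin R).
Proof. by apply: continuous_measurable_fun => x; exact: continuous_sin. Qed.

Lemma measurable_cos_scale (s : R) :
  measurable_fun setT (fun z : R => cos (s * z)%R).
Proof.
by apply: measurableT_comp; [exact: measurable_cos|exact: measurable_funM].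
Qed.

Lemma measurable_sin_scale (s : R) :
  measurable_fun setT (fun z : R => sin (s * z)%R).
Proof.
by apply: measurableT_comp; [exact: measurable_sin|exact: measurable_funM].
Qed.

Lemma normr_cos_le1 (x : R) : (`|cos x| <= 1)%R.
Proof. by rewrite ler_norml cos_geN1 cos_le1. Qed.

Lemma normr_sin_le1 (x : R) : (`|sin x| <= 1)%R.
Proof. by rewrite ler_norml sin_geN1 sin_le1. Qed.

Lemma integrable_stdgauss_cos (s : R) :
  gauss.-integrable setT (fun z => (cos (s * z)%R)%:E).
Proof.
apply: (@bounded_integrable _ _ _ _ _ 1); first exact: measurable_cos_scale.
by move=> z; exact: normr_cos_le1.
Qed.

Lemma integrable_stdgauss_sin (s : R) :
  gauss.-integrable setT (fun z => (sin (s * z)%R)%:E).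
Proof.
apply: (@bounded_integrable _ _ _ _ _ 1); first exact: measurable_sin_scale.
by move=> z; exact: normr_sin_le1.
Qed.

Lemma integral_cos_stdgauss (s : R) :
  \int[gauss]_z (cos (s * z))%:E = (gauss_cos s)%:E.
Proof.
rewrite fineK//; apply: integrable_fin_num => //.
exact: integrable_stdgauss_cos.
Qed.

Lemma integral_stdgauss_odd (f : R -> R) :
  measurable_fun setT f -> (forall z, f (- z)%R = - f z)%R ->
  gauss.-integrable setT (EFin \o f) ->
  \int[gauss]_z (f z)%:E = 0.
Proof.
move=> mf fN intf.
have intE : \int[gauss]_z (f z)%:E = - \int[gauss]_z (f z)%:E.
  rewrite [LHS](@same_law_integral R _ _ gauss _ _ gauss idfun -%R (EFin \o f))//.
  - under eq_integral do rewrite /= fN EFinN.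
    by rewrite integralN// integrable_add_def.
  - exact: measurable_id.
  - exact/measurable_EFinP.
  - by move=> A mA; exact: stdgauss_sym.
have : \int[gauss]_z (f z)%:E \is a fin_num by exact: integrable_fin_num.
move: intE; case: (\int[gauss]_z (f z)%:E) => //= r [] rN _; congr EFin; lra.
Qed.

Lemma integral_sin_stdgauss (s : R) : \int[gauss]_z (sin (s * z))%:E = 0.
Proof.
apply: integral_stdgauss_odd; first exact: measurable_sin_scale.
  by move=> z; rewrite mulrN sinN.
exact: integrable_stdgauss_sin.
Qed.

(** Both sides are the mean of [cos (a X + b Y)] for independent standard normal [X], [Y]: rotation
    invariance gives the left side, and the addition formula the right side, its sine terms
    vanishing by symmetry. *)
Lemma gauss_cos_sqrt (a b : R) :
  gauss_cos (Num.sqrt (a ^+ 2 + b ^+ 2)) = (gauss_cos a * gauss_cos b)%R.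
Proof.
apply: EFin_inj; rewrite -integral_cos_stdgauss.
have mab : measurable_fun setT (fun p : R * R => a * p.1 + b * p.2)%R.
  by apply: measurable_funD; exact: measurable_funM.
rewrite -(@same_law_integral R _ _ (gauss \x gauss) _ _ gauss
  (fun p : R * R => a * p.1 + b * p.2)%R
  (fun z => Num.sqrt (a ^+ 2 + b ^+ 2) * z)%R (EFin \o cos))//; first last.
- by move=> A mA; exact: stdgauss_conv.
- by apply/measurable_EFinP; exact: measurable_cos.
- exact: measurable_funM.
have mcos : measurable_fun setT (fun p : R * R => cos (a * p.1 + b * p.2)%R).
  by apply: measurableT_comp mab; exact: measurable_cos.
rewrite -integral12_prod_meas1/=; last first.
  by apply: (@bounded_integrable _ _ _ _ _ 1) => // p; exact: normr_cos_le1.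
have icos := integrable_stdgauss_cos.
have isin := integrable_stdgauss_sin.
have inner x : \int[gauss]_y (cos (a * x + b * y))%:E =
    (cos (a * x))%:E * (gauss_cos b)%:E.
  under eq_integral => y _ do rewrite cosD EFinB !EFinM.
  rewrite (@integralB _ _ _ _ _ measurableT); [|exact: integrableZl..].
  by rewrite !integralZl// integral_cos_stdgauss integral_sin_stdgauss mule0 sube0.
under eq_integral => x _ do rewrite /fubini_F /= inner.
by rewrite integralZr// integral_cos_stdgauss EFinM.
Qed.

End GaussianCos.

(** * Gaussian random vectors *)

Lemma integrable_of_sqr {disp : measure_display} {T : measurableType disp}
    {R : realType}
    (P : probability T R) (X : T -> R) : measurable_fun setT X ->
  P.-integrable setT (fun w => (X w ^+ 2)%:E) -> P.-integrable setT (EFin \o X).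
Proof.
move=> mX iX; apply: (@le_integrable _ _ _ P _ measurableT (EFin \o X)
  (fun w => (1 + X w ^+ 2)%:E)).
- exact/measurable_EFinP.
- move=> w _ /=; rewrite lee_fin [leRHS]ger0_norm ?addr_ge0 ?sqr_ge0//.
  rewrite ler_norml; apply/andP; split;
    have := sqr_ge0 (X w + 1); have := sqr_ge0 (X w - 1); nra.
- under eq_fun do rewrite EFinD.
  apply: integrableD => //.
  by apply: (@bounded_integrable _ _ _ _ (cst 1) 1) => // z; rewrite normr1.
Qed.

Lemma integrable_stdgauss_id {R : realType} : (@stdgauss R).-integrable setT EFin.
Proof.
have mid : measurable_fun [set: measurableTypeR R] (idfun : measurableTypeR R -> R).
  exact: measurable_id.
exact: (integrable_of_sqr mid integrable_stdgauss_sqr).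
Qed.

Section CenteredGaussian.
Context {disp : measure_display} {T : measurableType disp} {R : realType}.
Variable P : probability T R.
Local Notation gauss := (@stdgauss R).

(** Formulated as the law of [s] times a standard normal variable, so that [s = 0] is not a special
    case as it is in [gaussian_rv]. *)
Definition centered_gaussian (X : T -> R) (s : R) : Prop :=
  measurable_fun setT X /\ forall A, measurable A ->
    P (X @^-1` A) = gauss ((fun z => s * z) @^-1` A).

Lemma integral_stdgauss_id : (\int[gauss]_z z%:E = 0)%E.
Proof.
by apply: (integral_stdgauss_odd (f := id)) => //; exact: integrable_stdgauss_id.
Qed.

Lemma integral_stdgauss_affine (m s : R) : (\int[gauss]_z (m + s * z)%:E = m%:E)%E.
Proof.
under eq_integral do rewrite EFinD EFinM.
rewrite (@integralD _ _ _ _ _ measurableT); last 2 first.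
- by apply: (@bounded_integrable _ _ _ _ (cst m) `|m|).
- by apply: integrableZl => //; exact: integrable_stdgauss_id.
rewrite integralZl//; last exact: integrable_stdgauss_id.
rewrite integral_stdgauss_id mule0 adde0 integral_cst//.
by rewrite [X in (_ * X)%E](probability_setT gauss) mule1.
Qed.

Lemma gaussian_rv_centered (X : T -> R) :
  gaussian_rv P X -> ('E_P[X] = 0)%E -> exists2 s, 0 <= s & centered_gaussian X s.
Proof.
move=> [mX [m [s [s0 XE]]]] EX.
have lawX A : measurable A -> P (X @^-1` A) = gauss ((fun z => m + s * z) @^-1` A).
  move=> mA; rewrite XE//; have [->|sn0] := eqVneq s 0; last first.
    by rewrite normal_prob_affine// lt_neqAle eq_sym sn0.
  rewrite diracE; have [Am|Am] := boolP (m \in A).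
    rewrite inE in Am; rewrite (_ : _ @^-1` _ = [set: measurableTypeR R])
      ?probability_setT//.
    by apply/seteqP; split=> z //= _; rewrite mul0r addr0.
  rewrite notin_setE in Am.
  rewrite (_ : _ @^-1` _ = set0 :> set (measurableTypeR R)) ?measure0//.
  by apply/seteqP; split=> z //=; rewrite mul0r addr0.
have : ('E_P[X] = m%:E)%E.
  rewrite unlock -(integral_stdgauss_affine m s).
  apply: (@same_law_integral R _ _ P _ _ gauss X (fun z => m + s * z) EFin) => //.
  by apply: measurable_funD => //; exact: measurable_funM.
rewrite EX => -[m0]; exists s => //; split => // A mA.
by rewrite lawX// -m0; congr (gauss _); apply/seteqP; split => z /=; rewrite add0r.
Qed.

Lemma measurable_scale (s : R) : measurable_fun [set: measurableTypeR R]
    (fun z : measurableTypeR R => s * z : R).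
Proof. exact: measurable_funM. Qed.

Lemma centered_gaussian_sqr (X : T -> R) s : centered_gaussian X s ->
  P.-integrable setT (fun w => (X w ^+ 2)%:E) /\
  (\int[P]_w (X w ^+ 2)%:E = (s ^+ 2 * stdvar)%:E)%E.
Proof.
move=> [mX XE].
have sqrE : (\int[P]_w (X w ^+ 2)%:E = (s ^+ 2 * stdvar)%:E)%E.
  rewrite (@same_law_integral R _ _ P _ _ gauss X (fun z => s * z)
    (fun x => (x ^+ 2)%:E))//; last 2 first.
  - exact: measurable_scale.
  - by apply/measurable_EFinP; exact: measurable_funX.
  under eq_integral do rewrite exprMn EFinM.
  rewrite integralZl//; last exact: integrable_stdgauss_sqr.
  by rewrite stdvarE.
split=> //; apply/integrableP; split.
  by apply/measurable_EFinP; exact: measurable_funX.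
under eq_integral do rewrite /= ger0_norm ?sqr_ge0//.
by rewrite sqrE ltry.
Qed.

Lemma centered_gaussian_mean (X : T -> R) s : centered_gaussian X s ->
  ('E_P[X] = 0)%E.
Proof.
move=> [mX XE]; rewrite unlock -[RHS](integral_stdgauss_affine 0 s).
rewrite (@same_law_integral R _ _ P _ _ gauss X (fun z => s * z) EFin)//.
  by under [RHS]eq_integral do rewrite add0r.
exact: measurable_scale.
Qed.

Lemma integrable_mul_of_sqr (X Y : T -> R) :
  measurable_fun setT X -> measurable_fun setT Y ->
  P.-integrable setT (fun w => (X w ^+ 2)%:E) ->
  P.-integrable setT (fun w => (Y w ^+ 2)%:E) ->
  P.-integrable setT (fun w => (X w * Y w)%:E).
Proof.
move=> mX mY iX iY.
apply: (@le_integrable _ _ _ P _ measurableT (fun w => (X w * Y w)%:E)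
  (fun w => (X w ^+ 2 + Y w ^+ 2)%:E)).
- by apply/measurable_EFinP; exact: measurable_funM.
- move=> w _ /=; rewrite lee_fin [leRHS]ger0_norm ?addr_ge0 ?sqr_ge0//.
  rewrite ler_norml; apply/andP; split;
    have := sqr_ge0 (X w + Y w); have := sqr_ge0 (X w - Y w);
    have := sqr_ge0 (X w); have := sqr_ge0 (Y w); nra.
- by under eq_fun do rewrite EFinD; apply: integrableD.
Qed.

Lemma covariance_zero_mean (X Y : T -> R) :
  measurable_fun setT X -> measurable_fun setT Y ->
  P.-integrable setT (fun w => (X w ^+ 2)%:E) ->
  P.-integrable setT (fun w => (Y w ^+ 2)%:E) ->
  ('E_P[X] = 0)%E -> ('E_P[Y] = 0)%E ->
  (covariance P X Y = \int[P]_w (X w * Y w)%:E)%E.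
Proof.
move=> mX mY iX iY EX EY.
rewrite covarianceE; first by rewrite EX mul0e sube0 unlock.
- exact/Lfun1_integrable/integrable_of_sqr.
- exact/Lfun1_integrable/integrable_of_sqr.
- exact/Lfun1_integrable/integrable_mul_of_sqr.
Qed.

End CenteredGaussian.

Section GaussianVectors.
Context {disp : measure_display} {T : measurableType disp} {R : realType}.
Variable P : probability T R.

(* [S] is the covariance matrix divided by [stdvar]. *)
Definition gauss_vec n (Z : T -> 'cV[R]_n) (S : 'M[R]_n) : Prop :=
  S^T = S /\ forall c : 'rV[R]_n, 0 <= (c *m S *m c^T) 0 0 /\
    centered_gaussian P (fun w => (c *m Z w) 0 0) (Num.sqrt ((c *m S *m c^T) 0 0)).

Lemma gauss_vec_mulmx m n (Z : T -> 'cV[R]_n) S (A : 'M[R]_(m, n)) :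
  gauss_vec Z S -> gauss_vec (fun w => A *m Z w) (A *m S *m A^T).
Proof.
move=> [St ZS]; split; first by rewrite !trmx_mul trmxK St mulmxA.
move=> c; have := ZS (c *m A).
rewrite trmx_mul !mulmxA.
by under eq_fun do rewrite -mulmxA.
Qed.

Lemma gauss_vec_jointly n (Z : T -> 'cV[R]_n) S :
  gauss_vec Z S -> jointly_gaussian P Z.
Proof.
move=> [_ ZS] c; have [c0 [mZ ZE]] := ZS c; split => //.
exists 0, (Num.sqrt ((c *m S *m c^T) 0 0)); split; first exact: sqrtr_ge0.
move=> B mB; rewrite ZE//; case: eqVneq => [->|s0]; last first.
  rewrite normal_prob_affine ?lt_neqAle 1?eq_sym ?s0 ?sqrtr_ge0//.
  by congr (stdgauss _); apply/seteqP; split => z /=; rewrite add0r.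
rewrite diracE; have [B0|B0] := boolP (0 \in B).
  rewrite inE in B0; rewrite (_ : _ @^-1` _ = [set: measurableTypeR R])
    ?probability_setT//.
  by apply/seteqP; split=> z //= _; rewrite mul0r.
rewrite notin_setE in B0.
rewrite (_ : _ @^-1` _ = set0 :> set (measurableTypeR R)) ?measure0//.
by apply/seteqP; split=> z //=; rewrite mul0r.
Qed.

Lemma gauss_vec_zero_mean n (Z : T -> 'cV[R]_n) S :
  gauss_vec Z S -> zero_mean P Z.
Proof.
move=> [_ ZS] i; have [_ /centered_gaussian_mean <-] := ZS (delta_mx 0 i).
by congr expectation; apply/funext => w; rewrite -rowE mxE.
Qed.

Lemma covmxE m n (X : T -> 'cV[R]_m) (Y : T -> 'cV[R]_n) i j :
  covmx P X Y i j = fine (covariance P (fun w => X w i 0) (fun w => Y w j 0)).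
Proof. by rewrite mxE. Qed.

(** Polarization: [gauss_vec] gives the second moment of each single form, and the product of two
    forms is half of the square of the sum minus both squares. *)
Lemma gauss_vec_integral_mul n (Z : T -> 'cV[R]_n) S (a b : 'rV[R]_n) :
  gauss_vec Z S ->
  (\int[P]_w ((a *m Z w) 0 0 * (b *m Z w) 0 0)%:E =
   (stdvar * (a *m S *m b^T) 0 0)%:E)%E.
Proof.
move=> [St ZS].
have sq (c : 'rV[R]_n) : P.-integrable setT (fun w => (((c *m Z w) 0 0) ^+ 2)%:E) /\
    (\int[P]_w (((c *m Z w) 0 0) ^+ 2)%:E = (stdvar * (c *m S *m c^T) 0 0)%:E)%E.
  have [c0 /centered_gaussian_sqr[iZ ->]] := ZS c; split=> //.
  by rewrite sqr_sqrtr// mulrC.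
have -> : (fun w => ((a *m Z w) 0 0 * (b *m Z w) 0 0)%:E) =
    (fun w => (2^-1)%:E * ((((a + b) *m Z w) 0 0) ^+ 2)%:E
      - ((2^-1)%:E * (((a *m Z w) 0 0) ^+ 2)%:E
        + (2^-1)%:E * (((b *m Z w) 0 0) ^+ 2)%:E))%E.
  apply/funext => w; rewrite -!EFinM -EFinD; congr EFin.
  have -> : ((a + b) *m Z w) 0 0 = (a *m Z w) 0 0 + (b *m Z w) 0 0.
    by rewrite mulmxDl mxE.
  by field.
have [[ia Ea] [ib Eb] [iab Eab]] : [/\ _, _ & _] := And3 (sq a) (sq b) (sq (a + b)).
rewrite (@integralB _ _ _ _ _ measurableT); last 2 first.
- exact: integrableZl.
- by apply: integrableD => //; exact: integrableZl.
rewrite (@integralD _ _ _ _ _ measurableT); [|exact: integrableZl..].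
rewrite !integralZl// Ea Eb Eab -!EFinM -EFinD; congr EFin.
have baE : (b *m S *m a^T) 0 0 = (a *m S *m b^T) 0 0.
  have -> : b *m S *m a^T = (a *m S *m b^T)^T by rewrite !trmx_mul trmxK St mulmxA.
  by rewrite mxE.
have addE (A B : 'M[R]_1) : (A + B) 0 0 = A 0 0 + B 0 0 by rewrite mxE.
rewrite linearD/= mulmxDr !mulmxDl !addE baE.
by field.
Qed.

Lemma covmx_gauss_vec n p q (Z : T -> 'cV[R]_n) S (A : 'M[R]_(p, n))
    (B : 'M[R]_(q, n)) :
  gauss_vec Z S ->
  covmx P (fun w => A *m Z w) (fun w => B *m Z w) = stdvar *: (A *m S *m B^T).
Proof.
move=> ZS; apply/matrixP => i j; rewrite covmxE [RHS]mxE.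
have rowE m (C : 'M[R]_(m, n)) k : (fun w => (C *m Z w) k 0) =
  (fun w => (row k C *m Z w) 0 0).
  by apply/funext => w; rewrite -row_mul [RHS]mxE.
have [_ ZSc] := ZS; rewrite (rowE _ A i) (rowE _ B j).
have [_ Gi] := ZSc (row i A); have [_ Gj] := ZSc (row j B).
rewrite (covariance_zero_mean _ _ _ _ (centered_gaussian_mean Gi)
  (centered_gaussian_mean Gj)).
- rewrite (gauss_vec_integral_mul _ _ ZS) /=; congr (_ * _).
  by rewrite tr_row -!row_mul colE mulmxA -colE [LHS]mxE [LHS]mxE.
- by case: Gi.
- by case: Gj.
- by case: (centered_gaussian_sqr Gi).
- by case: (centered_gaussian_sqr Gj).
Qed.

Lemma covmx_gauss_vec_self n (Z : T -> 'cV[R]_n) S :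
  gauss_vec Z S -> covmx P Z Z = stdvar *: S.
Proof.
move=> ZS; have := covmx_gauss_vec 1%:M 1%:M ZS; rewrite mul1mx trmx1 mulmx1 => <-.
by under [in RHS]eq_fun do rewrite mul1mx.
Qed.

(** A centered Gaussian form has second moment [s ^+ 2 * stdvar]; expanding the same moment over
    pairs of coordinates gives the quadratic form of the covariance matrix, which identifies [s]. *)
Lemma jointly_gaussian_gauss_vec n (X : T -> 'cV[R]_n) :
  jointly_gaussian P X -> zero_mean P X ->
  gauss_vec X (stdvar^-1 *: covmx P X X).
Proof.
move=> gX EX.
have coord i : (fun w => (delta_mx (0 : 'I_1) i *m X w) 0 0) = (fun w => X w i 0).
  by apply/funext => w; rewrite -rowE mxE.
have Xi i : exists2 s, 0 <= s & centered_gaussian P (fun w => X w i 0) s.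
  by apply: gaussian_rv_centered (EX i); rewrite -coord; exact: gX.
have mXi i : measurable_fun setT (fun w => X w i 0) by have [s _ []] := Xi i.
have iXi i : P.-integrable setT (fun w => (X w i 0 ^+ 2)%:E).
  by have [s _ /centered_gaussian_sqr[]] := Xi i.
have iXij i j : P.-integrable setT (fun w => (X w i 0 * X w j 0)%:E).
  exact: integrable_mul_of_sqr.
have covE i j : (\int[P]_w (X w i 0 * X w j 0)%:E = (covmx P X X i j)%:E)%E.
  by rewrite covmxE covariance_zero_mean// fineK// integrable_fin_num.
have cX (c : 'rV[R]_n) : exists s, [/\ 0 <= s,
    centered_gaussian P (fun w => (c *m X w) 0 0) s &
    s ^+ 2 = (c *m (stdvar^-1 *: covmx P X X) *m c^T) 0 0].
  have Ec : ('E_P[fun w => (c *m X w) 0%R 0%R] = 0)%E.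
    rewrite unlock; under eq_integral do rewrite mxE -sumEFin.
    rewrite integral_sum//; last first.
      by move=> i; under eq_fun do rewrite EFinM; apply: integrableZl => //;
        exact: integrable_of_sqr.
    apply: big1 => i _; under eq_integral do rewrite EFinM.
    rewrite integralZl//; last exact: integrable_of_sqr.
    by have := EX i; rewrite unlock => ->; rewrite mule0.
  have [s s0 Gs] := gaussian_rv_centered (gX c) Ec; exists s; split => //.
  have [_ Es] := centered_gaussian_sqr Gs.
  apply: (mulIf (x := stdvar)); first by rewrite gt_eqF// stdvar_gt0.
  apply: EFin_inj; rewrite -Es.
  rewrite -scalemxAr -scalemxAl [in RHS]mxE mulrAC mulVf ?mul1r ?gt_eqF
    ?stdvar_gt0//.
  transitivity (\int[P]_w \sum_i \sum_j
    (c 0 i * c 0 j * (X w i 0 * X w j 0))%R%:E)%E.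
    apply: eq_integral => w _; under [RHS]eq_bigr do rewrite sumEFin.
    rewrite sumEFin; congr EFin; rewrite expr2 mxE big_distrlr/=.
    by apply: eq_bigr => i _; apply: eq_bigr => j _; ring.
  rewrite integral_sum//; last first.
    move=> i; apply: integrable_sum => // j _.
    by under eq_fun do rewrite EFinM; apply: integrableZl.
  under eq_bigr => i _.
    rewrite integral_sum//; last first.
      by move=> j; under eq_fun do rewrite EFinM; apply: integrableZl.
    under eq_bigr => j _.
      under eq_integral do rewrite EFinM.
      rewrite integralZl// covE -EFinM.
      over.
    rewrite sumEFin.
    over.
  rewrite sumEFin; congr EFin.
  rewrite mxE exchange_big/=; apply: eq_bigr => j _.
  rewrite mxE mulr_suml; apply: eq_bigr => i _.
  by rewrite [c^T _ _]mxE mulrAC.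
split.
  rewrite linearZ/=; congr (_ *: _); apply/matrixP => i j.
  by rewrite mxE !covmxE covarianceC.
move=> c; have [s [s0 Gs <-]] := cX c; split; first exact: sqr_ge0.
by rewrite sqrtr_sqr ger0_norm.
Qed.

End GaussianVectors.

(** Induction on the size: the Schur complement [C'] of the corner entry is again positive definite,
    and its factor is bordered by the scaled first column. *)
Lemma posdefmx_cholesky (R : realType) n (S : 'M[R]_n) :
  posdefmx S -> exists L : 'M[R]_n, S = L *m L^T.
Proof.
elim: n S => [|n IH] S; first by exists 0; apply/matrixP => -[].
rewrite -[n.+1]/(1 + n)%N in S *; move=> [St Sp].
pose a := S 0 0; pose b := ursubmx S; pose C := drsubmx S.
have SE : S = block_mx a%:M b b^T C.
  rewrite -[LHS]submxK; congr block_mx.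
    by rewrite [LHS]mx11_scalar; congr (_%:M); rewrite !mxE; congr (S _ _);
      apply/val_inj.
  by rewrite /b trmx_ursub St.
have Ct : C^T = C by rewrite /C trmx_drsub St.
have quad (x : 'cV[R]_1) (v : 'cV[R]_n) :
  (col_mx x v)^T *m S *m col_mx x v =
  x^T *m a%:M *m x + x^T *m b *m v + (v^T *m b^T *m x + v^T *m C *m v).
  rewrite SE tr_col_mx mul_row_block mul_row_col !mulmxDl -!addrA; congr (_ + _).
  by rewrite addrCA.
have a0 : 0 < a.
  have v0 : col_mx (1%:M : 'cV[R]_1) (0 : 'cV[R]_n) != 0.
    by rewrite col_mx_eq0 negb_and oner_neq0.
  have := Sp _ v0; rewrite quad !(trmx0, mulmx0, mul0mx, addr0).
  by rewrite trmx1 mul1mx mulmx1 mxE.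
pose C' := C - a^-1 *: (b^T *m b).
have [L' L'E] : exists L : 'M[R]_n, C' = L *m L^T.
  apply: IH; split.
    by rewrite /C' linearB linearZ/= trmx_mul trmxK Ct.
  (* For fixed [v], this first coordinate minimizes the quadratic form of [S], and the minimum is
     the form of the Schur complement at [v]. *)
  move=> v vn0; have := Sp (col_mx (- a^-1 *: (b *m v)) v).
  rewrite col_mx_eq0 (negbTE vn0) andbF => /(_ isT).
  have uT : (b *m v)^T = v^T *m b^T by rewrite trmx_mul.
  have xT : (- a^-1 *: (b *m v))^T = - a^-1 *: (b *m v)^T by rewrite linearZ.
  rewrite quad xT -[_ *: (b *m v)^T *m b *m v]mulmxA -uT.
  rewrite mul_mx_scalar -!(scalemxAl, scalemxAr) !scalerA.
  rewrite (_ : a * - a^-1 * - a^-1 = a^-1); last by field; rewrite gt_eqF.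
  rewrite /C' mulmxBr mulmxBl -scalemxAr -scalemxAl (mulmxA v^T) -uT
    -(mulmxA (b *m v)^T).
  by rewrite scaleNr addrN add0r addrC.
exists (block_mx (Num.sqrt a)%:M 0 ((Num.sqrt a)^-1 *: b^T) L').
have sa : Num.sqrt a != 0 by rewrite gt_eqF ?sqrtr_gt0.
rewrite tr_block_mx mulmx_block SE !(trmx0, mulmx0, mul0mx, addr0).
rewrite linearZ/= trmxK tr_scalar_mx -scalar_mxM -expr2 sqr_sqrtr ?ltW//.
congr block_mx.
- by rewrite mul_scalar_mx scalerA divff// scale1r.
- by rewrite mul_mx_scalar scalerA divff// scale1r.
- rewrite -L'E /C' -scalemxAl -scalemxAr scalerA -invfM -expr2 sqr_sqrtr ?ltW//.
  by rewrite addrC subrK.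
Qed.

(** * Existence of Gaussian vectors with a prescribed covariance *)

Section GaussianExistence.
Context {R : realType}.

(** Each step adjoins an independent standard normal coordinate on a product space. A linear form
    then splits into two independent centered Gaussian summands, which rotation invariance merges
    into one. *)
Lemma gauss_vec_std_exists (n : nat) :
  exists (disp : measure_display) (T : measurableType disp)
    (P : probability T R) (Z : T -> 'cV[R]_n), gauss_vec P Z 1%:M.
Proof.
elim: n => [|n [d [T [P [Z [_ ZE]]]]]].
  exists _, (measurableTypeR R), stdgauss, (fun=> 0); split; first by rewrite trmx1.
  move=> c; rewrite (_ : (_ *m _ *m _) 0 0 = 0); last first.
    by rewrite mxE big_ord0.
  split=> //; split.
    by under eq_fun do rewrite mulmx0 mxE; exact: measurable_cst.
  move=> A mA; rewrite sqrtr0; congr (stdgauss _).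
  by apply/seteqP; split => z /=; rewrite mulmx0 mxE mul0r.
exists _, (T * measurableTypeR R)%type, (P \x stdgauss)%E,
  (fun p => col_mx (p.2)%:M (Z p.1) : 'cV[R]_(1 + n)).
split; first by rewrite trmx1.
rewrite -[n.+1]/(1 + n)%N => c.
have -> : (c *m 1%:M *m c^T) 0 0 = lsubmx c 0 0 ^+ 2 +
  (rsubmx c *m 1%:M *m (rsubmx c)^T) 0 0.
  rewrite !mulmx1 -[in LHS](hsubmxK c) tr_row_mx mul_row_col mxE; congr (_ + _).
  by rewrite mxE big_ord1 [_^T _ _]mxE expr2.
set a := lsubmx c 0 0; have [q0 [mZ lawZ]] := ZE (rsubmx c).
set q := (rsubmx c *m 1%:M *m (rsubmx c)^T) 0 0 in q0 lawZ *.
have cE p : (c *m (col_mx (p.2)%:M (Z p.1) : 'cV[R]_(1 + n))) 0 0 =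
    (rsubmx c *m Z p.1) 0 0 + a * p.2.
  rewrite -[in LHS](hsubmxK c) mul_row_col mxE addrC; congr (_ + _).
  by rewrite mul_mx_scalar mxE mulrC.
split; first by rewrite addr_ge0 ?sqr_ge0.
under eq_fun do rewrite cE.
have mf : measurable_fun setT (fun p : R * R => p.1 + a * p.2).
  by apply: measurable_funD => //; exact: measurable_funM.
split.
  apply: measurable_funD; first exact: (measurableT_comp mZ).
  by apply: measurable_funM => //; exact: measurable_snd.
move=> A mA.
rewrite -(sqr_sqrtr q0) addrC -stdgauss_conv// /product_measure1.
(* The section depends on the first factor only through the value of the linear form, so the
   integral over [T] can be moved to the standard normal law. *)
pose h (x : R) : \bar R :=
  stdgauss (xsection ((fun p : R * R => p.1 + a * p.2) @^-1` A) x).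
have mh : measurable_fun setT h.
  apply: measurable_fun_xsection; rewrite -[X in measurable X]setTI; exact: mf.
transitivity (\int[P]_w h ((rsubmx c *m Z w) 0 0)%R)%E.
  by apply: eq_integral => w _; rewrite /h /=; congr (stdgauss _).
rewrite (@same_law_integral R _ _ P _ _ stdgauss _ (fun z => Num.sqrt q * z)
  h)//; last first.
  exact: measurable_scale.
Qed.

Lemma gauss_vec_exists n (S : 'M[R]_n) : posdefmx S ->
  exists (disp : measure_display) (T : measurableType disp)
    (P : probability T R) (Z : T -> 'cV[R]_n), gauss_vec P Z S.
Proof.
move=> /posdefmx_cholesky[L ->].
have [d [T [P [Z ZE]]]] := gauss_vec_std_exists n.
exists d, T, P, (fun w => L *m Z w).
by have := gauss_vec_mulmx L ZE; rewrite mulmx1.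
Qed.

End GaussianExistence.

(** * Uncorrelated Gaussian vectors are independent *)

Section StonePolynomial.
Context {R : realType}.
Implicit Types (x v : R) (N : nat).

Lemma bernoulli_ge (y : R) N : 0 <= y -> 1 + N%:R * y <= (1 + y) ^+ N.
Proof.
move=> y0; elim: N => [|N IH]; first by rewrite mul0r addr0.
rewrite exprS; apply: le_trans (ler_wpM2l _ IH); last by rewrite addr_ge0.
rewrite -natr1; have : 0 <= N%:R * y * y by rewrite !mulr_ge0.
nra.
Qed.

Lemma onem_expr_ge x N : 0 <= x <= 1 -> 1 - N%:R * x <= (1 - x) ^+ N.
Proof.
move=> /andP[x0 x1]; elim: N => [|N IH]; first by rewrite mul0r subr0.
rewrite exprS; apply: le_trans (ler_wpM2l _ IH); last by rewrite subr_ge0.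
rewrite -natr1; have : 0 <= N%:R * x * x by rewrite !mulr_ge0.
nra.
Qed.

(** By Bernoulli's inequality [1 + N * x] is at most [(1 + x) ^ N], and the product of the two
    powers is [(1 - x ^ 2) ^ N], at most 1. *)
Lemma onem_expr_le x N : 0 <= x <= 1 -> (1 - x) ^+ N <= (1 + N%:R * x)^-1.
Proof.
move=> /andP[x0 x1].
have N0 : 0 < 1 + N%:R * x by rewrite ltr_pwDl// mulr_ge0.
rewrite -[leRHS]mul1r ler_pdivlMr//.
apply: (@le_trans _ _ ((1 - x) ^+ N * (1 + x) ^+ N)).
  by rewrite ler_wpM2l ?bernoulli_ge// exprn_ge0// subr_ge0.
by rewrite -exprMn exprn_ile1//; nra.
Qed.

(* The exponent [N * 2 ^ N], rather than [2 ^ N], makes the limit at the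
   threshold [1/2] equal to 0 instead of [expR (-1)]. *)
Definition stone_poly N : {poly R} := (1 - 'X^N) ^+ (N * 2 ^ N).

Lemma stone_polyE N v : (stone_poly N).[v] = (1 - v ^+ N) ^+ (N * 2 ^ N).
Proof. by rewrite /stone_poly !hornerE. Qed.

Lemma stone_poly_itv N v : 0 <= v <= 1 -> 0 <= (stone_poly N).[v] <= 1.
Proof.
move=> /andP[v0 v1]; rewrite stone_polyE.
have w01 : 0 <= v ^+ N <= 1 by rewrite exprn_ge0//= exprn_ile1.
rewrite exprn_ge0 ?exprn_ile1//=; lra.
Qed.

(** With [u] the square root of [t], Bernoulli's inequality for the powers of [u^-1] bounds
    [N * u ^ N], and a second factor [u ^ N] remains to tend to 0. *)
Lemma cvg_natmul_expr (t : R) : 0 <= t < 1 -> N%:R * t ^+ N @[N --> \oo] -->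
    (0 : R).
Proof.
move=> /andP[t0 t1]; move: t0; rewrite le_eqVlt => /predU1P[<-|t0].
  apply: cvg_near_cst; apply: nearW => -[|N]; first by rewrite mul0r.
  by rewrite expr0n mulr0.
pose u := Num.sqrt t; have u0 : 0 < u by rewrite sqrtr_gt0.
have u1 : u < 1 by rewrite -sqrtr1 ltr_sqrt.
have y0 : 0 < u^-1 - 1 by rewrite subr_gt0 invf_gt1.
have uN N : N%:R * u ^+ N <= (u^-1 - 1)^-1.
  rewrite -[leRHS]mul1r ler_pdivlMr// mulrAC.
  have := bernoulli_ge N (ltW y0); rewrite [1 + (_ - 1)]addrC subrK exprVn => h.
  apply: (@le_trans _ _ ((u ^+ N)^-1 * u ^+ N)).
    by rewrite ler_wpM2r ?exprn_ge0 ?ltW//; lra.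
  by rewrite mulVf// expf_neq0// gt_eqF.
apply: (@squeeze_cvgr _ _ _ _ (cst 0) (fun N => (u^-1 - 1)^-1 * u ^+ N)).
- apply: nearW => N; apply/andP; split.
    by rewrite mulr_ge0// exprn_ge0// ltW.
  rewrite -(sqr_sqrtr (ltW t0)) -/u expr2 exprMn mulrA.
  by rewrite ler_wpM2r// exprn_ge0// ltW.
- exact: cvg_cst.
- rewrite -[X in _ --> X](mulr0 (u^-1 - 1)^-1); apply: cvgM; first exact: cvg_cst.
  by apply: cvg_expr; rewrite ger0_norm ?ltW.
Qed.

(** Below the threshold the value is at least [1 - N * (2 * v) ^ N], by Bernoulli; from the
    threshold on it is at most the inverse of [1 + N * (2 * v) ^ N], hence of [N + 1]. *)
Lemma cvg_stone_poly v : 0 <= v <= 1 ->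
  (stone_poly N).[v] @[N --> \oo] --> ((v < 2^-1)%R%:R : R).
Proof.
move=> v01; have /andP[v0 v1] := v01; have vN N : 0 <= v ^+ N <= 1.
  by rewrite exprn_ge0//= exprn_ile1.
have [v2|v2] := ltP v 2^-1.
- have t01 : 0 <= 2 * v < 1 by rewrite mulr_ge0//=; lra.
  apply: (@squeeze_cvgr _ _ _ _ (fun N => 1 - N%:R * (2 * v) ^+ N) (cst 1)).
  + apply: nearW => N; have /andP[_ ->] := stone_poly_itv N v01; rewrite andbT.
    rewrite stone_polyE; apply: le_trans (onem_expr_ge _ (vN N)).
    by rewrite natrM natrX -mulrA -exprMn.
  + rewrite -[X in _ --> X]subr0; apply: cvgB; first exact: cvg_cst.
    exact: cvg_natmul_expr.
  + exact: cvg_cst.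
- apply: (@squeeze_cvgr _ _ _ _ (cst 0) (fun N => N.+1%:R^-1)).
  + apply: nearW => N; have /andP[-> _] := stone_poly_itv N v01; rewrite /=.
    rewrite stone_polyE; apply: le_trans (onem_expr_le _ (vN N)) _.
    rewrite lef_pV2 ?posrE// ?ltr_pwDl ?mulr_ge0 ?exprn_ge0//.
    rewrite -natr1 addrC lerD2l natrM natrX -mulrA -exprMn ler_peMr//.
    by rewrite exprn_ege1//; lra.
  + exact: cvg_cst.
  + exact: cvg_harmonic.
Qed.

(** The sequence is eventually constant: once [x / m.+1] lies strictly between [-pi] and [pi], its
    sine has the sign of [x]. *)
Lemma cvg_sin_sign x :
  ((2^-1 + sin (x / m.+1%:R) / 2 < 2^-1)%R%:R : R) @[m --> \oo] -->
    ((x < 0)%R%:R : R).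
Proof.
apply: cvg_near_cst; near=> m; congr (nat_of_bool _)%:R.
have xm : `|x / m.+1%:R| < pi.
  rewrite normrM normfV (@ger0_norm _ m.+1%:R)// ltr_pdivrMr//.
  apply: (@lt_le_trans _ _ m.+1%:R); last first.
    by rewrite ler_peMl// (le_trans _ (pi_ge2 R))// ler1n.
  near: m; exists (Num.truncn `|x|) => // m /= xm.
  by rewrite (lt_le_trans (truncnS_gt _))// ler_nat.
rewrite gtrDl pmulr_llt0//.
have m0 : 0 < m.+1%:R^-1 :> R by rewrite invr_gt0.
have [x0|x0|->] := ltgtP x 0; last by rewrite mul0r sin0 ltxx.
- have : 0 < sin (- (x / m.+1%:R)).
    apply: sin_gt0_pi; rewrite oppr_gt0 pmulr_llt0// x0/=.
    by move: xm; rewrite ltr_norml => /andP[? _]; rewrite ltrNl.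
  by rewrite sinN oppr_gt0.
- have : 0 < sin (x / m.+1%:R).
    apply: sin_gt0_pi; rewrite divr_gt0//=.
    by move: xm; rewrite ltr_norml => /andP[].
  by move/ltW/le_gtF.
Unshelve. all: by end_near. Qed.

End StonePolynomial.

(** * Trigonometric polynomials of a random vector *)

Section Trigonometric.
Context {T : Type} {R : realType} {p : nat}.
Variable U : T -> 'cV[R]_p.

(** The free phase [t] makes cosines alone cover sines and constants, and keeps the class closed
    under products through the product-to-sum formula. *)
Inductive trig : (T -> R) -> Prop :=
| trig_cos (k : R) (r : 'rV[R]_p) (t : R) :
    trig (fun w => k * cos ((r *m U w) 0 0 + t))
| trig_add f g : trig f -> trig g -> trig (fun w => f w + g w).

Lemma trig_cst (k : R) : trig (fun=> k).
Proof.
rewrite (_ : (fun=> k) = (fun w => k * cos (((0 : 'rV[R]_p) *m U w) 0 0 + 0))).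
  exact: trig_cos.
by apply/funext => w; rewrite mul0mx mxE addr0 cos0 mulr1.
Qed.

Lemma trig_mul f g : trig f -> trig g -> trig (fun w => f w * g w).
Proof.
move=> tf; elim: tf g => [k r t g|f1 f2 _ IH1 _ IH2 g tg]; last first.
  rewrite (_ : (fun w => _) = fun w => f1 w * g w + f2 w * g w).
    by apply: trig_add; [exact: IH1|exact: IH2].
  by apply/funext => w; rewrite mulrDl.
elim=> [k' r' t'|g1 g2 _ IH1 _ IH2]; last first.
  rewrite (_ : (fun w => _) = fun w => k * cos ((r *m U w) 0 0 + t) * g1 w +
      k * cos ((r *m U w) 0 0 + t) * g2 w); first exact: trig_add.
  by apply/funext => w; rewrite mulrDr.
rewrite (_ : (fun w => _) = fun w =>
    k * k' / 2 * cos (((r + r') *m U w) 0 0 + (t + t')) +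
    k * k' / 2 * cos (((r - r') *m U w) 0 0 + (t - t'))).
  by apply: trig_add; exact: trig_cos.
apply/funext => w; rewrite mulmxDl mulmxBl.
have -> : (r *m U w + r' *m U w) 0 0 = (r *m U w) 0 0 +
  (r' *m U w) 0 0 by rewrite mxE.
have -> : (r *m U w - r' *m U w) 0 0 = (r *m U w) 0 0 - (r' *m U w) 0 0
  by rewrite !mxE.
set x := (r *m U w) 0 0; set y := (r' *m U w) 0 0.
rewrite (_ : x + y + (t + t') = (x + t) + (y + t')); last by ring.
rewrite (_ : x - y + (t - t') = (x + t) - (y + t')); last by ring.
by move: (x + t) (y + t') => a b; rewrite cosB cosD; field.
Qed.

Lemma trig_poly (q : {poly R}) f : trig f -> trig (fun w => q.[f w]).
Proof.
move=> tf; elim/poly_ind: q => [|q c IH].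
  by under eq_fun do rewrite horner0; exact: trig_cst.
under eq_fun do rewrite hornerMXaddC.
by apply: trig_add; [exact: trig_mul|exact: trig_cst].
Qed.

Lemma trig_prod (I : Type) (s : seq I) (f : I -> T -> R) :
  (forall i, trig (f i)) -> trig (fun w => \prod_(i <- s) f i w).
Proof.
move=> tf; elim: s => [|i s IH].
  by under eq_fun do rewrite big_nil; exact: trig_cst.
by under eq_fun do rewrite big_cons; exact: trig_mul.
Qed.

Lemma trig_half_sin (r : 'rV[R]_p) (a c : R) :
  trig (fun w => 2^-1 + sin (((r *m U w) 0 0 - a) / c) / 2).
Proof.
apply: trig_add; first exact: trig_cst.
rewrite (_ : (fun w => _) = fun w =>
  2^-1 * cos (((c^-1 *: r) *m U w) 0 0 + (- (a / c) - pi / 2))).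
  exact: trig_cos.
apply/funext => w.
have -> : ((c^-1 *: r) *m U w) 0 0 = (r *m U w) 0 0 / c.
  by rewrite -scalemxAl mxE mulrC.
by rewrite addrA cosBpihalf mulrC mulrBl.
Qed.

End Trigonometric.

Section TrigonometricIntegrals.
Context {disp : measure_display} {T : measurableType disp} {R : realType}.
Variable P : probability T R.
Local Notation gauss := (@stdgauss R).
Local Open Scope ereal_scope.

Lemma trig_measurable_bounded p (U : T -> 'cV[R]_p) f :
  (forall r : 'rV[R]_p, measurable_fun setT (fun w => (r *m U w) 0%R 0%R)) ->
  trig U f -> measurable_fun setT f /\ exists M, forall w, (`|f w| <= M)%R.
Proof.
move=> mU; elim=> [k r t|g h _ [mg [M gM]] _ [mh [N hN]]]; split.
- apply: measurable_funM => //; apply: measurableT_comp;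
    first exact: measurable_cos.
  exact: measurable_funD.
- exists `|k|%R => w; rewrite normrM ler_piMr//; exact: normr_cos_le1.
- exact: measurable_funD.
- by exists (M + N)%R => w; rewrite (le_trans (ler_normD _ _))// lerD.
Qed.

Lemma bounded_cvg_integral (h_ : (T -> R)^nat) (h : T -> R) (M : R) :
  (forall n, measurable_fun setT (h_ n)) -> (forall n w, (`|h_ n w| <= M)%R) ->
  (forall w, h_ ^~ w @ \oo --> h w) ->
  \int[P]_w (h_ n w)%:E @[n --> \oo] --> \int[P]_w (h w)%:E.
Proof.
move=> mh_ hM h_h.
have mh : measurable_fun setT h by exact: measurable_fun_cvg mh_ (fun w _ => h_h w).
have [] := @dominated_convergence _ T R P setT measurableT
  (fun n w => (h_ n w)%:E) (fun w => (h w)%:E) (fun=> M%:E) => //.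
- by move=> n; exact/measurable_EFinP.
- exact/measurable_EFinP.
- by apply: aeW => w _; apply/fine_cvgP; split; [exact: nearW|exact: h_h].
- by apply: (@bounded_integrable _ _ _ _ (cst M) `|M|).
- by apply: aeW => w n _ /=; rewrite lee_fin.
Qed.

Lemma gauss_vec_integral_cos n (Z : T -> 'cV[R]_n) S (c : 'rV[R]_n) (t : R) :
  gauss_vec P Z S ->
  \int[P]_w (cos ((c *m Z w) 0 0 + t))%R%:E =
  (cos t * gauss_cos (Num.sqrt ((c *m S *m c^T) 0 0)))%R%:E.
Proof.
move=> [_ /(_ c)[_ [mZ ZE]]].
set s := Num.sqrt _.
rewrite (@same_law_integral R _ _ P _ _ gauss _ (fun z => s * z)%R
  (fun x => (cos (x + t))%:E))//; last 2 first.
- exact: measurable_scale.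
- apply/measurable_EFinP; apply: measurableT_comp; first exact: measurable_cos.
  exact: measurable_funD.
under eq_integral do rewrite cosD EFinB !EFinM muleC [X in _ - X]muleC.
rewrite (@integralB _ _ _ _ _ measurableT).
- rewrite !integralZl//.
  + by rewrite integral_cos_stdgauss integral_sin_stdgauss mule0 sube0 EFinM.
  + exact: integrable_stdgauss_sin.
  + exact: integrable_stdgauss_cos.
- by apply: integrableZl => //; exact: integrable_stdgauss_cos.
- by apply: integrableZl => //; exact: integrable_stdgauss_sin.
Qed.

End TrigonometricIntegrals.

(** * From trigonometric polynomials to half-spaces *)

Section Halfspaces.
Context {disp : measure_display} {T : measurableType disp} {R : realType}.
Variable P : probability T R.
Local Open Scope ereal_scope.

Definition sigma_vec p (U : T -> 'cV[R]_p) : set (set T) :=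
  <<s \bigcup_(i in [set: 'I_p])
        preimage_set_system setT (fun w => U w i 0%R)
          (measurable : set (set R)) >>.

Definition measurable_forms p (U : T -> 'cV[R]_p) : Prop :=
  forall r : 'rV[R]_p, measurable_fun setT (fun w => (r *m U w) 0%R 0%R).

(** Lists of constraints give a pi-system: concatenation is intersection, and the empty list is the
    whole space. *)
Definition halfspaces p (U : T -> 'cV[R]_p) (s : seq ('rV[R]_p * R)) : set T :=
  [set w | all (fun x => (x.1 *m U w) 0 0 < x.2)%R s].

Definition bounded_measurable (f : T -> R) : Prop :=
  measurable_fun setT f /\ exists M, forall w, (`|f w| <= M)%R.

Lemma bounded_measurable_integrable f :
  bounded_measurable f -> P.-integrable setT (EFin \o f).
Proof. by move=> [mf [M fM]]; exact: bounded_integrable fM. Qed.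

Lemma bounded_measurableM f g : bounded_measurable f -> bounded_measurable g ->
  bounded_measurable (fun w => f w * g w)%R.
Proof.
move=> [mf [M fM]] [mg [N gN]]; split; first exact: measurable_funM.
by exists (M * N)%R => w; rewrite normrM ler_pM.
Qed.

Lemma bounded_measurable_indic (D : set T) : measurable D ->
  bounded_measurable (\1_D : T -> R).
Proof.
move=> mD; split; first exact: measurable_indic.
by exists 1%R => w; rewrite indicE; case: (_ \in _); rewrite ?normr0 ?normr1.
Qed.

Definition uncorrelated (f g : T -> R) : Prop :=
  \int[P]_w (f w * g w)%:E = \int[P]_w (f w)%:E * \int[P]_w (g w)%:E.

Lemma uncorrelated_sym f g : uncorrelated f g -> uncorrelated g f.
Proof.
by rewrite /uncorrelated muleC => <-; apply: eq_integral => w _; rewrite mulrC.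
Qed.

Lemma uncorrelatedD f1 f2 g : bounded_measurable f1 -> bounded_measurable f2 ->
  bounded_measurable g -> uncorrelated f1 g -> uncorrelated f2 g ->
  uncorrelated (fun w => f1 w + f2 w)%R g.
Proof.
rewrite /uncorrelated => bf1 bf2 bg u1 u2.
under eq_integral do rewrite mulrDl EFinD.
under [in RHS]eq_integral do rewrite EFinD.
rewrite !(@integralD _ _ _ _ _ measurableT);
  try exact: bounded_measurable_integrable;
  try exact/bounded_measurable_integrable/bounded_measurableM.
have fin f : bounded_measurable f -> \int[P]_w (f w)%:E \is a fin_num.
  by move=> bf; apply: integrable_fin_num =>
    //; exact: bounded_measurable_integrable.
rewrite u1 u2; move: (fin _ bf1) (fin _ bf2) (fin _ bg).
move: (\int[P]_w (f1 w)%:E) (\int[P]_w (f2 w)%:E) (\int[P]_w (g w)%:E) =>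
  a b c fa fb fc.
by rewrite muleDl// fin_num_adde_defr.
Qed.

Lemma uncorrelated_cvg (h_ : (T -> R)^nat) (h g : T -> R) :
  (forall n, measurable_fun setT (h_ n)) -> (forall n w, (`|h_ n w| <= 1)%R) ->
  bounded_measurable g ->
  (forall w, h_ ^~ w @ \oo --> h w) ->
  (forall n, uncorrelated (h_ n) g) -> uncorrelated h g.
Proof.
move=> mh h1 bg hh ug; have [mg [M gM]] := bg.
have cg : \int[P]_w (h_ n w * g w)%:E @[n --> \oo] --> \int[P]_w (h w * g w)%:E.
  apply: (@bounded_cvg_integral _ _ _ P _ _ M).
  - by move=> n; exact: measurable_funM.
  - by move=> n w; rewrite normrM (le_trans _ (gM w))// ler_piMl.
  - by move=> w; apply: cvgM; [exact: hh|exact: cvg_cst].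
have c1 : \int[P]_w (h_ n w)%:E @[n --> \oo] --> \int[P]_w (h w)%:E.
  exact: (@bounded_cvg_integral _ _ _ P _ _ 1).
apply: (cvg_unique _ cg) => //.
have -> : (fun n => \int[P]_w (h_ n w * g w)%:E) =
    (fun n => \int[P]_w (h_ n w)%:E * \int[P]_w (g w)%:E).
  by apply/funext => n; exact: ug.
have : \int[P]_w (g w)%:E \is a fin_num.
  by apply: integrable_fin_num => //; exact: bounded_measurable_integrable.
by move=> gfin; apply: cvgeZr.
Qed.

Lemma cvg_prod_seq (I : Type) (s : seq I) (f_ : nat -> I -> R) (f : I -> R) :
  (forall i, f_ ^~ i @ \oo --> f i) ->
  (\prod_(i <- s) f_ n i)%R @[n --> \oo] --> (\prod_(i <- s) f i)%R.
Proof.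
move=> ff; elim: s => [|i s IH].
  by under eq_fun do rewrite big_nil; rewrite big_nil; exact: cvg_cst.
by under eq_fun do rewrite big_cons; rewrite big_cons; apply: cvgM;
  [exact: ff|exact: IH].
Qed.

Lemma normr_prod_le1 (I : Type) (s : seq I) (f : I -> R) :
  (forall i, `|f i| <= 1)%R -> (`|\prod_(i <- s) f i| <= 1)%R.
Proof.
move=> f1; apply: (big_ind (fun x => `|x| <= 1)%R); rewrite ?normr1//.
by move=> x y x1 y1; rewrite normrM mulr_ile1.
Qed.

(* The indicator of [y < a] is the limit in [m] of that of [sin ((y - a) / m) < 0],
   which is a limit of polynomials in [sin ((y - a) / m)]. *)
Lemma uncorrelated_halfspaces p (U : T -> 'cV[R]_p) (g : T -> R) s :
  measurable_forms U -> bounded_measurable g ->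
  (forall f, trig U f -> uncorrelated f g) ->
  uncorrelated \1_(halfspaces U s) g.
Proof.
move=> mU bg ug.
(* This rescaling of the sine into the unit interval moves the sign change to [2^-1], the threshold
   of [stone_poly]. *)
pose v (m : nat) (x : 'rV[R]_p * R) w :=
  (2^-1 + sin (((x.1 *m U w) 0 0 - x.2) / m.+1%:R) / 2)%R.
have v01 m x w : (0 <= v m x w <= 1)%R.
  rewrite /v; set y := sin _.
  by have := sin_geN1 ((((x.1 *m U w) 0 0 - x.2) / m.+1%:R)%R : R);
    have := sin_le1 ((((x.1 *m U w) 0 0 - x.2) / m.+1%:R)%R : R); rewrite -/y; lra.
pose hN m N w := (\prod_(x <- s) (stone_poly N).[v m x w])%R.
pose h m w := (\prod_(x <- s) ((v m x w < 2^-1)%R%:R : R))%R.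
have th m N : trig U (hN m N).
  by apply: trig_prod => x; apply: trig_poly; exact: trig_half_sin.
have mhN m N : measurable_fun setT (hN m N).
  by have [] := trig_measurable_bounded mU (th m N).
have chN m w : hN m ^~ w @ \oo --> h m w.
  by apply: cvg_prod_seq => x; exact: cvg_stone_poly.
have mh m : measurable_fun setT (h m).
  by apply: (measurable_fun_cvg (mhN m)) => w _; exact: chN.
apply: (@uncorrelated_cvg h) => //.
- move=> n w; apply: normr_prod_le1 => x.
  by case: (_ < _)%R; rewrite ?normr0 ?normr1.
- move=> w; rewrite (_ : \1_(halfspaces U s) w =
    (\prod_(x <- s) (((x.1 *m U w) 0 0 - x.2 < 0)%R%:R : R))%R).
    by apply: cvg_prod_seq => x; exact: cvg_sin_sign.
  rewrite indicE; rewrite (_ : (w \in _) =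
    all (fun x => (x.1 *m U w) 0 0 - x.2 < 0)%R s).
    elim: s {hN h th mhN chN mh} => [|x s IH]; first by rewrite big_nil.
    by rewrite big_cons -IH /= -mulnb natrM.
  apply/idP/idP; rewrite ?inE /halfspaces /= => a; rewrite ?inE /=.
    by rewrite (eq_all (a2 := fun x => (x.1 *m U w) 0 0 < x.2)%R)// => x;
      rewrite subr_lt0.
  by rewrite (eq_all (a2 := fun x => (x.1 *m U w) 0 0 - x.2 < 0)%R)// => x;
    rewrite subr_lt0.
- move=> m; apply: (@uncorrelated_cvg (hN m)) => //.
  + move=> n w; apply: normr_prod_le1 => x.
    by have /andP[? ?] := stone_poly_itv n (v01 m x w); rewrite ger0_norm.
  + by move=> N; apply: ug.
Qed.

Lemma measurable_halfspaces p (U : T -> 'cV[R]_p) s :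
  measurable_forms U -> measurable (halfspaces U s).
Proof.
move=> mU; elim: s => [|x s IH].
  by rewrite (_ : halfspaces U [::] = setT)//; apply/seteqP; split.
rewrite (_ : halfspaces U (x :: s) =
   (fun w => (x.1 *m U w) 0%R 0%R) @^-1` `]-oo, x.2[%classic `&` halfspaces U s).
  by apply: measurableI => //; rewrite -[X in measurable X]setTI; exact: mU.
apply/seteqP; split => w /=; rewrite /halfspaces /= in_itv/=.
  by move/andP.
by move=> [-> ->].
Qed.

End Halfspaces.

Section GaussianIndependence.
Context {disp : measure_display} {T : measurableType disp} {R : realType}.
Variable P : probability T R.
Local Open Scope ereal_scope.

Definition indep_events (F G : set (set T)) : Prop :=
  forall A B, F A -> G B -> P (A `&` B) = P A * P B.

Lemma gauss_vec_forms p n (Z : T -> 'cV[R]_n) S (A : 'M[R]_(p, n)) :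
  gauss_vec P Z S -> measurable_forms (fun w => A *m Z w).
Proof.
move=> [_ ZS] r; have [_ [mZ _]] := ZS (r *m A).
by under eq_fun do rewrite mulmxA.
Qed.

(** By bilinearity only two cosines matter. Their product is half the sum of the cosines of the
    forms [a + b] and [a - b]. As the cross terms vanish, both forms have the same variance, the sum
    of those of [a] and [b], so [gauss_cos_sqrt] yields the same product for both, and the phases
    recombine into [cos t * cos t']. *)
Lemma gauss_vec_uncorrelated_trig n p q (Z : T -> 'cV[R]_n) S
    (A : 'M[R]_(p, n)) (B : 'M[R]_(q, n)) f g :
  gauss_vec P Z S -> (A *m S *m B^T = 0)%R ->
  trig (fun w => A *m Z w) f -> trig (fun w => B *m Z w) g ->
  uncorrelated P f g.
Proof.
move=> ZS AB.
have bA h : trig (fun w => A *m Z w) h -> bounded_measurable h.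
  exact/trig_measurable_bounded/(gauss_vec_forms A ZS).
have bB h : trig (fun w => B *m Z w) h -> bounded_measurable h.
  exact/trig_measurable_bounded/(gauss_vec_forms B ZS).
move=> tf; elim: tf g => [k r t g|f1 f2 t1 IH1 t2 IH2 g tg]; last first.
  by apply: uncorrelatedD; [exact: bA|exact: bA|exact: bB|exact: IH1|exact: IH2].
have b1 : bounded_measurable (fun w => k * cos ((r *m (A *m Z w)) 0 0 + t))%R.
  by apply: bA; exact: trig_cos.
elim=> [k' r' t'|g1 g2 t1 IH1 t2 IH2]; last first.
  by apply: uncorrelated_sym; apply: uncorrelatedD;
    [exact: bB|exact: bB|exact: b1|exact: uncorrelated_sym|exact: uncorrelated_sym].
have symS (x y : 'rV[R]_n) : (x *m S *m y^T = (y *m S *m x^T)^T)%R.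
  by have [St _] := ZS; rewrite !trmx_mul trmxK St mulmxA.
pose a := (r *m A)%R; pose b := (r' *m B)%R.
have ab : (a *m S *m b^T = 0)%R.
  by rewrite /a /b trmx_mul !mulmxA -(mulmxA r A S) -(mulmxA r) AB mulmx0 mul0mx.
have ba : (b *m S *m a^T = 0)%R.
  by rewrite symS ab trmx0.
have icos (c : 'rV[R]_n) u (l : R) : P.-integrable setT (fun w =>
  (l * cos ((c *m Z w) 0 0 + u))%R%:E).
  apply: (@bounded_integrable _ _ _ _ _ `|l|%R).
    apply: measurable_funM => //; apply: measurableT_comp;
      first exact: measurable_cos.
    by apply: measurable_funD => //; have [_ /(_ c)[_ []]] := ZS.
  by move=> w; rewrite normrM ler_piMr//; exact: normr_cos_le1.
have Ecos (c : 'rV[R]_n) u (l : R) : \int[P]_w (l * cos ((c *m Z w) 0 0 + u))%R%:E =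
    (l * (cos u * gauss_cos (Num.sqrt ((c *m S *m c^T) 0 0))))%R%:E.
  under eq_integral do rewrite EFinM.
  rewrite integralZl// ?(gauss_vec_integral_cos _ _ ZS)//.
  by have := icos c u 1%R; under eq_fun do rewrite mul1r.
have quad s : s = 1%R \/ s = (-1)%R ->
   (((a + s *: b) *m S *m (a + s *: b)^T) 0 0 =
    Num.sqrt ((a *m S *m a^T) 0 0) ^+ 2 + Num.sqrt ((b *m S *m b^T) 0 0) ^+ 2)%R.
  move=> s1; have [_ Sp] := ZS; rewrite !sqr_sqrtr; last 2 first.
  - by case: (Sp b).
  - by case: (Sp a).
  have -> : ((a + s *: b) *m S *m (a + s *: b)^T = a *m S *m a^T + b *m S *m b^T)%R.
    rewrite linearD/= [(s *: b)^T]linearZ/= !(mulmxDl, mulmxDr) -!(scalemxAl,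
      scalemxAr).
    by rewrite ab ba !scaler0 addr0 add0r scalerA; case: s1 => ->;
      rewrite ?mulrNN mulr1 scale1r.
  by rewrite mxE.
rewrite /uncorrelated.
transitivity (\int[P]_w ((k * k' / 2 *
  cos (((a + 1 *: b) *m Z w) 0 0 + (t + t')))%R%:E +
   (k * k' / 2 * cos (((a + -1 *: b) *m Z w) 0 0 + (t - t')))%R%:E)).
  apply: eq_integral => w _; rewrite -EFinD; congr EFin.
  rewrite !mulmxA -/a -/b scale1r scaleN1r mulmxDl mulmxBl.
  have -> : ((a *m Z w + b *m Z w) 0 0 = (a *m Z w) 0 0 + (b *m Z w) 0 0)%R
    by rewrite mxE.
  have -> : ((a *m Z w - b *m Z w) 0 0 = (a *m Z w) 0 0 - (b *m Z w) 0 0)%R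
    by rewrite !mxE.
  set x := ((a *m Z w) 0 0)%R; set y := ((b *m Z w) 0 0)%R.
  rewrite (_ : x + y + (t + t') = (x + t) + (y + t'))%R; last by ring.
  rewrite (_ : x - y + (t - t') = (x + t) - (y + t'))%R; last by ring.
  by move: (x + t)%R (y + t')%R => {}x {}y; rewrite cosB cosD; field.
rewrite (@integralD _ _ _ _ _ measurableT)//.
under [X in _ = X * _]eq_integral do rewrite mulmxA -/a.
under [X in _ = _ * X]eq_integral do rewrite mulmxA -/b.
rewrite !Ecos -EFinD -EFinM; congr EFin.
rewrite !quad; [|by right|by left].
rewrite gauss_cos_sqrt cosB cosD.
by field.
Qed.

Lemma sigma_vec_halfspaces p (U : T -> 'cV[R]_p) :
  sigma_vec U `<=` <<s range (halfspaces U) >>.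
Proof.
apply: smallest_sub; first exact: smallest_sigma_algebra.
move=> _ [i _ [B mB <-]].
have mUi : @measurable_fun _ _ (g_sigma_algebraType (range (halfspaces U))) R setT
    (fun w => U w i 0%R).
  apply: (measurability (@RGenInftyO.G R)); first exact: RGenInftyO.measurableE.
  move=> _ [_ [x ->] <-]; apply: sub_sigma_algebra.
  exists [:: (delta_mx (0%R : 'I_1) i, x)] => //.
  apply/seteqP; split => w; rewrite /halfspaces /= -rowE mxE in_itv/= andbT;
    last by case.
  by split.
exact: mUi.
Qed.

(** Both sides are finite measures in [E], the restriction of [P] to [D] and a multiple of [P]; they
    agree on a pi-system generating a sigma-algebra that contains [sigma_vec U]. *)
Lemma indep_sigma_vec_event p (U : T -> 'cV[R]_p) (D : set T) :
  measurable_forms U -> measurable D ->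
  (forall s, P (halfspaces U s `&` D) = P (halfspaces U s) * P D) ->
  forall E, sigma_vec U E -> P (E `&` D) = P E * P D.
Proof.
move=> mU mD hD E /sigma_vec_halfspaces sE.
have PD : P D = (fine (P D))%:E by rewrite fineK// fin_num_measure.
have D0 : (0 <= fine (P D))%R by rewrite fine_ge0.
pose m1 : {measure set T -> \bar R} := mrestr P mD.
pose m2 : {measure set T -> \bar R} := mscale (NngNum D0) P.
suff : m1 E = m2 E by rewrite /m1 /m2 /= /mrestr /mscale /= -PD muleC.
apply: (g_sigma_algebra_measure_unique (range (halfspaces U)) _ (fun=> setT)) => //.
- by move=> _ [s _ <-]; exact: measurable_halfspaces.
- by move=> _; exists [::] => //; apply/seteqP; split.
- by rewrite bigcup_const.
- move=> _ _ [s _ <-] [s' _ <-]; exists (s ++ s') => //.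
  by apply/seteqP; split => w; rewrite /halfspaces /= all_cat; move/andP.
- by move=> _ [s _ <-]; rewrite /m1 /m2 /= /mrestr /mscale /= -PD muleC hD.
- by move=> _; rewrite /m1 /= /mrestr setTI -ge0_fin_numE// fin_num_measure.
Qed.

Theorem gauss_vec_indep n p q (Z : T -> 'cV[R]_n) S
    (A : 'M[R]_(p, n)) (B : 'M[R]_(q, n)) :
  gauss_vec P Z S -> (A *m S *m B^T = 0)%R ->
  indep_events (sigma_vec (fun w => A *m Z w)) (sigma_vec (fun w => B *m Z w)).
Proof.
move=> ZS AB E F sE sF.
have mA := gauss_vec_forms A ZS; have mB := gauss_vec_forms B ZS.
have sub r (U : T -> 'cV[R]_r) D : measurable_forms U -> sigma_vec U D ->
  measurable D.
  move=> mU; move: D; apply: smallest_sub; first exact: sigma_algebra_measurable.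
  move=> _ [i _ [C mC <-]].
  have mUi : measurable_fun setT (fun w => U w i 0%R).
    have := mU (delta_mx (0%R : 'I_1) i); congr measurable_fun.
    by apply/funext => w; rewrite -rowE mxE.
  exact: mUi.
have mF := sub _ _ _ mB sF.
have indicE (X Y : set T) : measurable X -> measurable Y ->
    uncorrelated P \1_X \1_Y -> P (X `&` Y) = P X * P Y.
  move=> mX mY; rewrite /uncorrelated !integral_indic// !setIT => <-.
  rewrite -[in LHS](setIT (X `&` Y)) -integral_indic//; last exact: measurableI.
  by apply: eq_integral => w _; rewrite indicI.
(* The pi-system argument is used on one side at a time, which leaves two half-space events; their
   indicators are then approximated one at a time as well. *)
apply: (indep_sigma_vec_event mA mF _ sE) => s; rewrite setIC muleC.
apply: (indep_sigma_vec_event mB _ _ sF); first exact: measurable_halfspaces.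
move=> s'; apply: indicE; [exact: measurable_halfspaces|exact:
  measurable_halfspaces|].
apply: uncorrelated_halfspaces => //.
  by apply: bounded_measurable_indic; exact: measurable_halfspaces.
move=> g tg; apply: uncorrelated_sym; apply: uncorrelated_halfspaces => //.
  exact: trig_measurable_bounded mB tg.
by move=> f tf; exact: gauss_vec_uncorrelated_trig ZS AB tf tg.
Qed.

End GaussianIndependence.

(** * Conditional independence *)

Section ConditionalIndependence.
Context {disp : measure_display} {T : measurableType disp} {R : realType}.
Variable P : probability T R.
Local Open Scope ereal_scope.

Definition sub_sigma_algebra_of (F : set (set T)) : Prop :=
  sigma_algebra setT F /\ F `<=` measurable.

Lemma measurable_fun_coarse (F : set (set T)) : sub_sigma_algebra_of F ->
  measurable_fun setT (idfun : T -> g_sigma_algebraType F).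
Proof.
move=> [sF mF] _ A; rewrite setTI preimage_id.
by rewrite (measurable_g_measurableTypeE sF) => /mF.
Qed.

(** Pullbacks along the diagonal form a sigma-algebra containing both [F] and [G]. Events of the
    join thus become sets in two separate variables, one of which can be frozen. *)
Lemma sigma_join_diag (F G : set (set T)) (A : set T) :
  sigma_algebra setT F -> sigma_algebra setT G -> <<s G `|` F >> A ->
  exists2 B : set (g_sigma_algebraType F * g_sigma_algebraType G),
    measurable B & A = (fun w => (w, w)) @^-1` B.
Proof.
move=> sF sG sA.
pose d w : g_sigma_algebraType F * g_sigma_algebraType G := (w, w).
suff : preimage_set_system setT d measurable A.
  by move=> [B mB <-]; exists B => //; rewrite setTI.
move: A sA; apply: smallest_sub.
  apply: sigma_algebra_preimage; exact: sigma_algebra_measurable.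
move=> A [GA|FA].
- exists (setT `*` A); last by apply/seteqP; split => w //=; case => _ [].
  by apply: measurableX => //; rewrite measurable_g_measurableTypeE.
- exists (A `*` setT); last by apply/seteqP; split => w //=; case => _ [].
  by apply: measurableX => //; rewrite measurable_g_measurableTypeE.
Qed.

Section Join.
Variables (U V H : set (set T)).
Hypotheses (sU : sub_sigma_algebra_of U) (sV : sub_sigma_algebra_of V)
  (sH : sub_sigma_algebra_of H).
Hypothesis UV : indep_events P U V.
Hypothesis UVH : indep_events P <<s U `|` V >> H.

Local Notation TU := (g_sigma_algebraType U).
Local Notation TV := (g_sigma_algebraType V).
Local Notation TH := (g_sigma_algebraType H).

(** Seen as a map to [T] with a coarser sigma-algebra, the identity has as its law the restriction
    of [P]; independence of sigma-algebras then says that the law of a diagonal map is a product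
    measure. *)
Let idU : {mfun T >-> TU} :=
  HB.pack (idfun : T -> TU) (isMeasurableFun.Build _ _ T TU
    idfun (measurable_fun_coarse sU)).
Let idV : {mfun T >-> TV} :=
  HB.pack (idfun : T -> TV) (isMeasurableFun.Build _ _ T TV
    idfun (measurable_fun_coarse sV)).
Let idH : {mfun T >-> TH} :=
  HB.pack (idfun : T -> TH) (isMeasurableFun.Build _ _ T TH
    idfun (measurable_fun_coarse sH)).
Let PU : probability TU R := distribution P idU.
Let PV : probability TV R := distribution P idV.
Let PH : probability TH R := distribution P idH.

Let PUV : probability (TU * TV)%type R := (PU \x PV).

Let diag_UV (W : set (TU * TV)) : measurable W ->
  P ((fun w => (w, w)) @^-1` W) = PUV W.
Proof.
move=> mW.
have md : measurable_fun setT (fun w : T => (w, w) : TU * TV).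
  by apply: measurable_fun_pair; exact: measurable_fun_coarse.
pose d : {mfun T >-> (TU * TV)%type} := HB.pack (fun w : T => (w, w) : TU * TV)
  (isMeasurableFun.Build _ _ _ _ _ md).
rewrite /PUV /= (@product_measure_unique _ _ _ _ _ PU PV (distribution P d))//
  => A B mA mB.
have UA : U A by rewrite -(measurable_g_measurableTypeE sU.1).
have VB : V B by rewrite -(measurable_g_measurableTypeE sV.1).
exact: UV.
Qed.

Let diag_join (W : set (TU * TV)) : measurable W ->
  <<s U `|` V >> ((fun w => (w, w)) @^-1` W).
Proof.
move=> mW.
have mF (F : set (set T)) : sigma_algebra setT F -> F `<=` U `|` V ->
    measurable_fun setT (idfun : g_sigma_algebraType (U `|` V) ->
      g_sigma_algebraType F).
  move=> sF FUV _ A; rewrite setTI preimage_id (measurable_g_measurableTypeE sF).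
  by move=> /FUV; exact: sub_sigma_algebra.
have md : measurable_fun setT (fun w : g_sigma_algebraType (U `|` V) =>
  (w, w) : TU * TV).
  apply: measurable_fun_pair.
    by apply: mF; [exact: sU.1|exact: subsetUl].
  by apply: mF; [exact: sV.1|exact: subsetUr].
by have := md measurableT _ mW; rewrite setTI.
Qed.

Let diag_HUV (E : set (TH * (TU * TV))) : measurable E ->
  P ((fun w => (w, (w, w))) @^-1` E) = (PH \x PUV) E.
Proof.
move=> mE.
have md : measurable_fun setT (fun w : T => (w, (w, w)) : TH * (TU * TV)).
  by do 2?[apply: measurable_fun_pair; try exact: measurable_fun_coarse].
pose d : {mfun T >-> (TH * (TU * TV))%type} :=
  HB.pack (fun w : T => (w, (w, w)) : TH * (TU * TV))
  (isMeasurableFun.Build _ _ _ _ _ md).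
rewrite (@product_measure_unique _ _ _ _ _ PH PUV (distribution P d))// =>
  C W mC mW.
have HC : H C by rewrite -(measurable_g_measurableTypeE sH.1).
by have := UVH (diag_join mW) HC; rewrite setIC muleC diag_UV.
Qed.

(* Sections of a set on the diagonal give everywhere defined versions of the
   conditional probabilities given [H]. *)
Let kernel_U (A : set (TH * TU)) (w : TH) : R := fine (PU (xsection A w)).
Let kernel_V (B : set (TH * TV)) (w : TH) : R := fine (PV (xsection B w)).

(** Over [w] in [C], the section of [E] is the rectangle of the sections of [A] and [B], so its
    product measure is the product of the kernels; integrating over [w] gives the product measure of
    [E], which is the probability of its diagonal trace. *)
Let integral_kernels A B C : measurable A -> measurable B -> H C ->
  \int[P]_(w in C) (kernel_U A w * kernel_V B w)%:E =
  P ((fun w => (w, w)) @^-1` A `&` (fun w => (w, w)) @^-1` B `&` C).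
Proof.
move=> mA mB HC; have mC : measurable (C : set TH).
  by rewrite (measurable_g_measurableTypeE sH.1).
pose E : set (TH * (TU * TV)) :=
  [set p | [/\ A (p.1, p.2.1), B (p.1, p.2.2) & C p.1]].
have mE : measurable E.
  rewrite (_ : E = (fun p => (p.1, p.2.1)) @^-1` A `&`
    ((fun p => (p.1, p.2.2)) @^-1` B `&` fst @^-1` C)).
    apply: measurableI.
      rewrite -[X in measurable X]setTI.
      suff : measurable_fun setT (fun p : TH * (TU * TV) => (p.1, p.2.1)) by exact.
      by apply: measurable_fun_pair => //; apply: measurableT_comp.
    apply: measurableI.
      rewrite -[X in measurable X]setTI.
      suff : measurable_fun setT (fun p : TH * (TU * TV) => (p.1, p.2.2)) by exact.
      by apply: measurable_fun_pair => //; apply: measurableT_comp.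
    rewrite -[X in measurable X]setTI.
    suff : measurable_fun setT (fst : TH * (TU * TV) -> TH) by exact.
    exact: measurable_fst.
  by apply/seteqP; split => p /=; [case|case=> ? []].
have -> : (fun w => (w, w)) @^-1` A `&` (fun w => (w, w)) @^-1` B `&` C =
    (fun w => (w, (w, w))) @^-1` E.
  by apply/seteqP; split => w /=; [case=> [[]]|case].
rewrite diag_HUV// /product_measure1.
rewrite integral_mkcond ge0_integral_distribution//;
  last exact: measurable_fun_xsection.
apply: eq_integral => w _ /=; rewrite patchE; case: ifPn => wC.
  rewrite (_ : xsection E w = xsection A w `*` xsection B w).
    rewrite [RHS]product_measure1E;
      [|exact: measurable_xsection|exact: measurable_xsection].
    by rewrite EFinM /kernel_U /kernel_V !fineK// fin_num_measure//;
      exact: measurable_xsection.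
  rewrite inE in wC.
  by apply/seteqP; split => -[u v]; rewrite /xsection /= !inE /=; [case|case].
rewrite (_ : xsection E w = set0) ?measure0//.
rewrite notin_setE in wC.
by apply/seteqP; split => -[u v]; rewrite /xsection /= ?inE //=; case.
Qed.

Lemma cond_indep_join (F G : set (set T)) :
  F `<=` <<s U `|` H >> -> G `<=` <<s V `|` H >> -> cond_indep P F G H.
Proof.
move=> FU GV A B /FU sA /GV sB.
have [A' mA' AE] := sigma_join_diag sH.1 sU.1 sA.
have [B' mB' BE] := sigma_join_diag sH.1 sV.1 sB.
have mkU : measurable_fun setT (kernel_U A').
  by apply: measurableT_comp => //; exact: measurable_fun_xsection.
have mkV : measurable_fun setT (kernel_V B').
  by apply: measurableT_comp => //; exact: measurable_fun_xsection.
have le1 d (T' : measurableType d) (Q : probability T' R) D : measurable D ->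
    (`|fine (Q D)| <= 1)%R.
  move=> mD; rewrite ger0_norm ?fine_ge0// -lee_fin fineK ?fin_num_measure//.
  exact: probability_le1.
have version (f : TH -> R) D : measurable_fun setT f -> (forall w, `|f w| <= 1)%R ->
    (forall C, H C -> \int[P]_(w in C) (f w)%:E = P (D `&` C)) ->
    cond_prob_version P H D f.
  move=> mf f1 fD; split => //.
    move=> X mX; rewrite -(measurable_g_measurableTypeE sH.1) -[_ @^-1` _]setTI.
    exact: mf.
  apply: (@bounded_integrable _ _ _ P f 1) => //.
  exact: (measurableT_comp mf (measurable_fun_coarse sH)).
have kU1 w : (`|kernel_U A' w| <= 1)%R by apply: le1; exact: measurable_xsection.
have kV1 w : (`|kernel_V B' w| <= 1)%R by apply: le1; exact: measurable_xsection.
exists (kernel_U A'), (kernel_V B'); split; apply: version => //.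
(* With the full set as second event the other kernel is constantly 1, and the joint identity
   specializes to the one for [A] alone. *)
- move=> C HC; have := integral_kernels mA' measurableT HC.
  rewrite preimage_setT setIT AE => <-; apply: eq_integral => w _.
  by rewrite /kernel_V (_ : xsection _ _ = setT) ?probability_setT ?mulr1//;
    apply/seteqP; split => // x _; rewrite /xsection /= inE.
- move=> C HC; have := integral_kernels measurableT mB' HC.
  rewrite preimage_setT setTI BE => <-; apply: eq_integral => w _.
  by rewrite /kernel_U (_ : xsection _ _ = setT) ?probability_setT ?mul1r//;
    apply/seteqP; split => // x _; rewrite /xsection /= inE.
- exact: measurable_funM.
- by move=> w; rewrite normrM mulr_ile1.
- by move=> C HC; rewrite AE BE; exact: integral_kernels.
Qed.

End Join.
End ConditionalIndependence.

(** * Block matrices *)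

Section LinearAlgebra.
Context {R : realType}.

Lemma mulmx_ext m n (A B : 'M[R]_(m, n)) :
  (forall v : 'cV[R]_n, A *m v = B *m v) -> A = B.
Proof.
move=> AB; apply/matrixP => i j; have /matrixP/(_ i 0) := AB (delta_mx j 0).
by rewrite -!colE !mxE.
Qed.

Lemma unitmx_ker0 n (A : 'M[R]_n) :
  (forall v : 'cV[R]_n, A *m v = 0 -> v = 0) -> A \in unitmx.
Proof.
move=> A0; rewrite -unitmx_tr -row_free_unit -kermx_eq0; apply/eqP/row_matrixP => i.
rewrite row0; apply: trmx_inj; rewrite trmx0; apply: A0.
have : row i (kermx A^T) *m A^T = 0 by rewrite -row_mul mulmx_ker row0.
by move=> /(congr1 trmx); rewrite trmx_mul trmxK trmx0.
Qed.

Lemma posdefmx_unit n (A : 'M[R]_n) : posdefmx A -> A \in unitmx.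
Proof.
move=> [_ Ap]; apply: unitmx_ker0 => v Av; apply/eqP/negPn/negP => /Ap.
by rewrite -mulmxA Av mulmx0 mxE ltxx.
Qed.

Lemma posdefmx1 n : posdefmx (1%:M : 'M[R]_n).
Proof.
split=> [|v v0]; first by rewrite trmx1.
rewrite mulmx1 mxE lt_neqAle sumr_ge0 ?andbT; last first.
  by move=> i _; rewrite mxE -expr2 sqr_ge0.
apply: contra v0; rewrite eq_sym psumr_eq0; last first.
  by move=> i _; rewrite mxE -expr2 sqr_ge0.
move=> /allP v0; apply/eqP/colP => i; rewrite mxE.
by have := v0 i (mem_index_enum _); rewrite mxE -expr2 sqrf_eq0 => /eqP.
Qed.

Lemma posdefmx_ge0 n (A : 'M[R]_n) (v : 'cV[R]_n) : posdefmx A ->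
  0 <= (v^T *m A *m v) 0 0.
Proof.
move=> [_ Ap]; have [->|v0] := eqVneq v 0; first by rewrite mulmx0 mxE.
exact/ltW/Ap.
Qed.

Lemma posdefmx_congr n (A L : 'M[R]_n) : posdefmx A -> L \in unitmx ->
  posdefmx (L^T *m A *m L).
Proof.
move=> [At Ap] Lu; split; first by rewrite !trmx_mul trmxK At mulmxA.
move=> v v0; have Lv : L *m v != 0.
  by apply: contra v0 => /eqP Lv; rewrite -(mulKmx Lu v) Lv mulmx0.
by have := Ap _ Lv; rewrite trmx_mul !mulmxA.
Qed.

Lemma posdefmx_inv n (A : 'M[R]_n) : posdefmx A -> posdefmx (invmx A).
Proof.
move=> Ap; have Au := posdefmx_unit Ap.
have := @posdefmx_congr _ A (invmx A) Ap; rewrite unitmx_inv => /(_ Au).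
by rewrite trmx_inv (proj1 Ap) mulVmx// mul1mx.
Qed.

(* [p] is thought of as a coordinate projection: the compression [p A p] of a
   positive definite matrix is invertible on the range of [p]. *)
Lemma posdefmx_compression n (A p : 'M[R]_n) : posdefmx A -> p^T = p ->
  p *m p = p -> exists W, p = W *m (p *m A *m p).
Proof.
(* [Q] completes the compression by the identity on the kernel of [p], which makes it invertible; as
   [Q *m p] is the compression itself, the inverse of [Q] serves as [W]. *)
move=> [At Ap] pt pp; pose Q := p *m A *m p + (1%:M - p).
have Qu : Q \in unitmx.
  apply: unitmx_ker0 => v Qv.
  have pAv : p *m A *m p *m v = 0.
    have := congr1 (mulmx p) Qv; rewrite mulmx0 /Q mulmxA mulmxDr !mulmxA.
    by rewrite mulmxBr mulmx1 pp subrr addr0.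
  have pv : p *m v = v.
    move: Qv; rewrite /Q mulmxDl pAv add0r mulmxBl mul1mx => /eqP.
    by rewrite subr_eq0 => /eqP.
  apply/eqP/negPn/negP => /Ap; rewrite -{1}pv trmx_mul pt -!mulmxA.
  have -> : p *m (A *m v) = 0 by rewrite -[RHS]pAv -[RHS]mulmxA pv mulmxA.
  by rewrite mulmx0 mxE ltxx.
exists (invmx Q); apply: (canRL (mulKmx Qu));
  rewrite /Q mulmxDl mulmxBl mul1mx pp subrr addr0.
by rewrite -!mulmxA pp.
Qed.

End LinearAlgebra.

Section BlockMatrices.
Context {R : realType} (m d : nat).
Implicit Types (B : 'I_m -> 'I_m -> 'M[R]_d) (D : 'I_m -> 'M[R]_d).

Definition blockmx B : 'M[R]_(\sum_(k < m) d) := \mxblock_(i < m, j < m) B i j.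
Definition blockcol (y : 'I_m -> 'cV[R]_d) : 'cV[R]_(\sum_(k < m) d) :=
    \mxcol_(i < m) y i.
Definition blockdiag D := blockmx (fun i j => if i == j then D i else 0).
(** Projections of full size keep past, present and future in one vector space, with no submatrices
    whose dimensions depend on the time [k]. *)
Definition blockmask (J : pred 'I_m) :=
    blockdiag (fun i => if J i then 1%:M else 0).

Lemma blockcolK (v : 'cV[R]_(\sum_(k < m) d)) : blockcol (submxcol v) = v.
Proof. exact: submxcolK. Qed.

Lemma blockmx_col B y : blockmx B *m blockcol y =
    blockcol (fun i => \sum_j B i j *m y j).
Proof. exact: mul_mxblock_mxrow. Qed.

Lemma blockmxM B B' : blockmx B *m blockmx B' =
    blockmx (fun i j => \sum_k B i k *m B' k j).
Proof. exact: mul_mxblock. Qed.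

Lemma tr_blockmx B : (blockmx B)^T = blockmx (fun i j => (B j i)^T).
Proof. exact: tr_mxblock. Qed.

Lemma eq_blockmx B B' : (forall i j, B i j = B' i j) -> blockmx B = blockmx B'.
Proof. by move=> BB'; apply: eq_mxblock. Qed.

Lemma eq_blockcol y y' : y =1 y' -> blockcol y = blockcol y'.
Proof. by move=> yy'; apply: eq_mxcol. Qed.

Lemma blockmx_inj B B' : blockmx B = blockmx B' -> forall i j, B i j = B' i j.
Proof. by move=> /eq_mxblockP. Qed.

Lemma blockcol_inj y y' : blockcol y = blockcol y' -> y =1 y'.
Proof. by move=> /eq_mxcolP. Qed.

Lemma blockdiagM D B : blockdiag D *m blockmx B = blockmx (fun i j => D i *m B i j).
Proof.
rewrite blockmxM; apply: eq_blockmx => i j; rewrite (bigD1 i)//= eqxx big1 ?addr0//.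
by move=> k ki; rewrite eq_sym (negbTE ki) mul0mx.
Qed.

Lemma blockmxDiag D B : blockmx B *m blockdiag D =
    blockmx (fun i j => B i j *m D j).
Proof.
rewrite blockmxM; apply: eq_blockmx => i j; rewrite (bigD1 j)//= eqxx big1 ?addr0//.
by move=> k kj; rewrite (negbTE kj) mulmx0.
Qed.

Lemma blockdiag_col D y : blockdiag D *m blockcol y =
    blockcol (fun i => D i *m y i).
Proof.
rewrite blockmx_col; apply: eq_blockcol => i;
  rewrite (bigD1 i)//= eqxx big1 ?addr0//.
by move=> k ki; rewrite eq_sym (negbTE ki) mul0mx.
Qed.

Lemma blockmx0 : blockmx (fun _ _ => 0) = 0.
Proof. exact: mxblock0. Qed.

Lemma blockmask_sym J : (blockmask J)^T = blockmask J.
Proof.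
rewrite tr_blockmx; apply: eq_blockmx => i j; rewrite eq_sym.
case: eqP => [->|_]; last by rewrite trmx0.
by case: ifP; rewrite ?trmx1 ?trmx0.
Qed.

Lemma blockmaskM J J' : blockmask J *m blockmask J' = blockmask (predI J J').
Proof.
rewrite blockdiagM; apply: eq_blockmx => i j.
case: eqP => [->|_]; last by rewrite mulmx0.
by rewrite /= ; case: (J j); case: (J' j); rewrite ?mulmx1 ?mulmx0.
Qed.

Lemma blockmask_idem J : blockmask J *m blockmask J = blockmask J.
Proof.
by rewrite blockmaskM; apply: eq_blockmx => i j; rewrite /= andbb.
Qed.

Lemma blockmask0 : blockmask pred0 = 0.
Proof. by rewrite -blockmx0; apply: eq_blockmx => i j; case: eqP. Qed.

Lemma blockmask_comp0 (J J' : pred 'I_m) B : (forall i j, J i -> J' j ->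
    B i j = 0) ->
  blockmask J *m blockmx B *m blockmask J' = 0.
Proof.
move=> B0; rewrite blockdiagM blockmxDiag -blockmx0; apply: eq_blockmx => i j.
case: ifP => Ji; last by rewrite !mul0mx.
by case: ifP => Jj; rewrite ?mulmx0// mul1mx mulmx1 B0.
Qed.

Lemma blockmask_sum3 (J1 J2 J3 : pred 'I_m) :
  (forall i, (J1 i + J2 i + J3 i = 1)%N) -> blockmask J1 + blockmask J2 +
    blockmask J3 = 1%:M.
Proof.
move=> J; apply: mulmx_ext => v;
  rewrite mul1mx -(blockcolK v) !mulmxDl !blockdiag_col.
rewrite /blockcol -!mxcolD; apply: eq_mxcol => i; rewrite -!mulmxDl.
have := J i; case: (J1 i); case: (J2 i); case: (J3 i) => //= _;
  by rewrite ?(addr0, add0r) mul1mx.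
Qed.

Lemma blockcol_quad D y :
  (blockcol y)^T *m blockdiag D *m blockcol y = \sum_i (y i)^T *m D i *m y i.
Proof.
rewrite -mulmxA blockdiag_col /blockcol tr_mxcol mul_mxrow_mxcol.
by apply: eq_bigr => i _; rewrite mulmxA.
Qed.

Lemma posdefmx_blockdiag D : (forall i, posdefmx (D i)) -> posdefmx (blockdiag D).
Proof.
move=> Dp; split.
  rewrite tr_blockmx; apply: eq_blockmx => i j; rewrite eq_sym.
  by case: eqP => [->|_]; [case: (Dp j)|rewrite trmx0].
move=> v v0; rewrite -(blockcolK v) blockcol_quad summxE.
have [i vi] : exists i, submxcol v i != 0.
  apply/existsP; apply: contraNT v0; rewrite negb_exists => /forallP v0.
  apply/eqP; rewrite -(blockcolK v) -[RHS](@mxcol0 _ _ (fun=> d)).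
  by apply: eq_mxcol => i; have := v0 i; rewrite negbK => /eqP.
rewrite (bigD1 i)//= ltr_pwDl//; first by case: (Dp i) => _; apply.
by apply: sumr_ge0 => j _; exact: posdefmx_ge0.
Qed.

End BlockMatrices.

(** * The matrix of the model and its precision matrix *)

Section CMLMatrices.
Context {R : realType} (d N : nat).
Variables (Gp Gl : nat -> 'M[R]_d) (G0N : 'M[R]_d).

Definition cml_coef (i j : nat) : 'M[R]_d :=
  (if (0 < i < N)%N && (j.+1 == i) then Gp i else 0) +
  (if j == N then if (0 < i < N)%N then Gl i else if i == 0%N then G0N else 0
    else 0).

Definition cml_block (i j : nat) : 'M[R]_d :=
  (if i == j then 1%:M else 0) - cml_coef i j.

(** The model together with its boundary condition says that this matrix sends the stacked sequence
    to the stacked noise. *)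
Definition cml_mx : 'M[R]_(\sum_(k < N.+1) d) :=
  blockmx (fun i j : 'I_N.+1 => cml_block i j).

Definition cml_mean (y : nat -> 'cV[R]_d) (i : nat) : 'cV[R]_d :=
  if (0 < i < N)%N then Gp i *m y i.-1 + Gl i *m y N
  else if i == 0%N then G0N *m y N else 0.

Lemma cml_mx_col (y : nat -> 'cV[R]_d) :
  cml_mx *m blockcol (fun k : 'I_N.+1 => y k) =
  blockcol (fun k : 'I_N.+1 => y k - cml_mean y k).
Proof.
rewrite blockmx_col; apply: eq_blockcol => i.
under eq_bigr do rewrite mulmxBl mulmxDl.
rewrite sumrB big_split/=; congr (_ - _).
  rewrite (bigD1 i)//= eqxx mul1mx big1 ?addr0// => j ji.
  by rewrite eq_sym (_ : (j == i :> nat) = false) ?mul0mx//; exact/negbTE.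
have -> : \sum_(j < N.+1) (if j == N :> nat then if (0 < i < N)%N then Gl i
    else if i == 0%N :> nat then G0N else 0 else 0) *m y j =
    (if (0 < i < N)%N then Gl i else if i == 0%N :> nat then G0N else 0) *m y N.
  rewrite (bigD1 ord_max)//= eqxx big1 ?addr0// => j jN.
  by rewrite (_ : (j == N :> nat) = false) ?mul0mx//; exact/negbTE.
rewrite /cml_mean; case: ifPn => iN /=; last first.
  rewrite big1 ?add0r; first by case: ifP; rewrite ?mul0mx.
  by move=> j _; rewrite mul0mx.
have [i0 iN'] := andP iN.
have i1 : (i.-1 < N.+1)%N by rewrite (leq_ltn_trans (leq_pred _)).
rewrite (bigD1 (inord i.-1))//= inordK// prednK// eqxx big1 ?addr0// => j ji.
rewrite (_ : (j.+1 == i) = false) ?mul0mx//; apply: contraNF ji => /eqP ji.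
by apply/eqP/val_inj; rewrite /= inordK// -ji.
Qed.

(** Without noise the boundary condition forces the state at [N] to vanish, then the state at 0, and
    the model propagates zero forward from there. *)
Lemma cml_mx_unit : (0 < N)%N -> cml_mx \in unitmx.
Proof.
move=> N0; apply: unitmx_ker0 => v Lv; rewrite -(blockcolK v).
pose y k := submxcol v (inord k : 'I_N.+1).
have vE : blockcol (submxcol v) = blockcol (fun k : 'I_N.+1 => y k).
  by apply: eq_blockcol => i; rewrite /y inord_val.
have : cml_mx *m blockcol (fun k : 'I_N.+1 => y k) = blockcol (fun=> 0).
  by rewrite -vE blockcolK Lv; rewrite /blockcol mxcol0.
rewrite cml_mx_col => /blockcol_inj yE.
have yE' k : (k <= N)%N -> y k = cml_mean y k.
  move=> kN; have := yE (inord k); rewrite inordK// => /eqP.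
  by rewrite subr_eq0 => /eqP.
have yN : y N = 0.
  have := yE' N (leqnn N); rewrite /cml_mean ltnn andbF => ->.
  by rewrite gtn_eqF.
rewrite vE (_ : blockcol _ = blockcol (fun=> 0)); first exact: mxcol0.
apply: eq_blockcol => -[k /= kN]; elim: k kN => [|k IH] kN.
  by rewrite yE'// /cml_mean/= yN mulmx0.
rewrite yE'// /cml_mean; case: ifP => //= _.
by rewrite yN IH ?ltnS 1?ltnW// !mulmx0 addr0.
Qed.

Definition cml_precision (D : nat -> 'M[R]_d) : 'M[R]_(\sum_(k < N.+1) d) :=
  cml_mx^T *m blockdiag (fun i : 'I_N.+1 => invmx (D i)) *m cml_mx.

Lemma cml_precisionE D : cml_precision D = blockmx (fun a b : 'I_N.+1 =>
  \sum_(i < N.+1) (cml_block i a)^T *m invmx (D i) *m cml_block i b).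
Proof.
rewrite /cml_precision /cml_mx tr_blockmx blockmxDiag blockmxM.
exact: eq_blockmx.
Qed.

Lemma cml_block_eq0 i j : (j < N)%N -> i != j -> i != j.+1 -> cml_block i j = 0.
Proof.
move=> jN ij ij1; rewrite /cml_block /cml_coef (negbTE ij) (ltn_eqF jN).
by rewrite (eq_sym j.+1) (negbTE ij1) andbF addr0 subr0.
Qed.

(* The only nonadjacent coupling left in the precision matrix is that between
   [x_a] and [x_N]; it is [- G_a^-1 G_{a,N} + G_{a+1,a}' G_{a+1}^-1 G_{a+1,N}]. *)
Lemma cml_precision_tridiag (D : nat -> 'M[R]_d) :
  (forall a, (a.+1 < N)%N ->
    invmx (D a) *m (if (0 < a)%N then Gl a else G0N) =
    (Gp a.+1)^T *m invmx (D a.+1) *m Gl a.+1) ->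
  forall a b : 'I_N.+1, (a.+1 < b)%N ->
    \sum_(i < N.+1) (cml_block i a)^T *m invmx (D i) *m cml_block i b = 0.
Proof.
move=> rec a b ab; have aN : (a.+1 < N)%N by rewrite (leq_trans ab)// -ltnS.
(* A state before time [N] enters only its own equation and the next one, so two nonadjacent such
   states share no equation; for [b = N] only the equations of times [a] and [a.+1] remain. *)
have [bN|] := ltnP b N.
  rewrite big1// => i _; have [ia|ia] := leqP i a.+1.
    rewrite (@cml_block_eq0 i b) ?mulmx0// ltn_eqF//.
      exact: leq_ltn_trans ia ab.
    by rewrite (leq_ltn_trans ia)// ltnW.
  rewrite (@cml_block_eq0 i a) ?trmx0 ?mul0mx//.
  - exact: ltnW.
  - by rewrite gtn_eqF// ltnW.
  - by rewrite gtn_eqF.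
move=> Nb; have {b ab Nb}-> : nat_of_ord b = N by apply/eqP;
  rewrite eqn_leq Nb -ltnS ltn_ord.
have a1 : (a.+1 < N.+1)%N by rewrite ltnW.
rewrite (bigD1 a)//= (bigD1 (Ordinal a1))//=; last first.
  by rewrite -val_eqE /= gtn_eqF.
rewrite big1 ?addr0; last first.
  move=> i /andP[ia ia1]; rewrite (@cml_block_eq0 i a (ltnW aN) ia ia1).
  by rewrite trmx0 !mul0mx.
have -> : cml_block a a = 1%:M.
  by rewrite /cml_block /cml_coef eqxx (ltn_eqF (ltnW aN)) (gtn_eqF (ltnSn a))
    andbF addr0 subr0.
have -> : cml_block a N = - (if (0 < a)%N then Gl a else G0N).
  rewrite /cml_block /cml_coef (ltn_eqF (ltnW aN)) eqxx sub0r.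
  rewrite (gtn_eqF (leq_trans (ltnW aN) (leqnSn N))) andbF add0r (ltnW aN) andbT.
  by case: posnP.
have -> : cml_block a.+1 a = - Gp a.+1.
  by rewrite /cml_block /cml_coef (gtn_eqF (ltnSn a)) sub0r aN eqxx
    (ltn_eqF (ltnW aN)) addr0.
have -> : cml_block a.+1 N = - Gl a.+1.
  rewrite /cml_block /cml_coef (ltn_eqF aN) sub0r eqxx aN /=.
  by rewrite (gtn_eqF (leq_trans aN (leqnSn N))) add0r.
by rewrite trmx1 mul1mx [(- Gp _)^T]linearN/= !mulNmx !mulmxN opprK rec// addNr.
Qed.

End CMLMatrices.

(** * Markov property *)

Section GeneratedSigmaAlgebras.
Context {disp : measure_display} {T : measurableType disp} {R : realType}.

Definition measurable_wrt (G : set (set T)) (f : T -> R) : Prop :=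
  measurable_fun setT (f : g_sigma_algebraType G -> R).

Lemma measurable_wrt_preimage (G : set (set T)) f : measurable_wrt G f ->
  preimage_set_system setT f measurable `<=` <<s G >>.
Proof. by move=> mf _ [B mB <-]; exact: mf. Qed.

Lemma measurable_wrt_gen (G : set (set T)) f :
  preimage_set_system setT f measurable `<=` <<s G >> -> measurable_wrt G f.
Proof. by move=> fG _ B mB; apply: fG; exists B. Qed.

Lemma measurable_wrt_mulmx (G : set (set T)) p n (W : T -> 'cV[R]_n)
    (M : 'M[R]_(p, n)) :
  (forall i, measurable_wrt G (fun w => W w i 0)) ->
  forall i, measurable_wrt G (fun w => (M *m W w) i 0).
Proof.
move=> mW i; rewrite /measurable_wrt; under eq_fun do rewrite mxE.
by apply: measurable_sum => j; apply: measurable_funM => //; exact: mW.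
Qed.

Lemma measurable_wrt_sigma_vec p (U : T -> 'cV[R]_p) (G : set (set T)) :
  sigma_vec U `<=` <<s G >> -> forall i, measurable_wrt G (fun w => U w i 0).
Proof.
move=> UG i; apply: measurable_wrt_gen; apply: subset_trans UG.
by apply: subset_trans (@sub_sigma_algebra _ _ _) => A UA; exists i.
Qed.

Lemma sigma_vec_sub p (U : T -> 'cV[R]_p) (G : set (set T)) :
  (forall i, measurable_wrt G (fun w => U w i 0)) -> sigma_vec U `<=` <<s G >>.
Proof.
move=> mU; apply: smallest_sub; first exact: smallest_sigma_algebra.
by move=> A [i _ UA]; exact: measurable_wrt_preimage (mU i) _ UA.
Qed.

Lemma sigma_seq_sub d (x : nat -> T -> 'cV[R]_d) (J : set nat) (G : set (set T)) :
  (forall k i, J k -> measurable_wrt G (fun w => x k w i 0)) ->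
  sigma_seq x J `<=` <<s G >>.
Proof.
move=> mx; apply: smallest_sub; first exact: smallest_sigma_algebra.
by move=> A [k Jk [i _ UA]]; exact: measurable_wrt_preimage (mx k i Jk) _ UA.
Qed.

Lemma measurable_wrt_sigma_seq d (x : nat -> T -> 'cV[R]_d) (J : set nat)
    (G : set (set T)) k i :
  sigma_seq x J `<=` <<s G >> -> J k -> measurable_wrt G (fun w => x k w i 0).
Proof.
move=> xG Jk; apply: measurable_wrt_gen; apply: subset_trans xG.
by apply: subset_trans (@sub_sigma_algebra _ _ _) => A UA; exists k => //; exists i.
Qed.

Lemma sigma_vec_measurable p (U : T -> 'cV[R]_p) :
  (forall i, measurable_fun setT (fun w => U w i 0)) ->
  sub_sigma_algebra_of (sigma_vec U).
Proof.
move=> mU; split; first exact: smallest_sigma_algebra.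
apply: smallest_sub; first exact: sigma_algebra_measurable.
by move=> _ [i _ [B mB <-]]; exact: mU.
Qed.

End GeneratedSigmaAlgebras.

Lemma blockcolE (R : realType) m d (y : 'I_m -> 'cV[R]_d) s :
  blockcol y s 0 = y (tagnat.sig1 s) (tagnat.sig2 s) 0.
Proof. by rewrite mxE. Qed.

Lemma blockcol_Rank (R : realType) m d (y : 'I_m -> 'cV[R]_d) i (j : 'I_d) :
  blockcol y (tagnat.Rank (p_ := fun=> d) i j) 0 = y i j 0.
Proof. by have /matrixP/(_ j 0) <- := mxcolK y i; rewrite [RHS]mxE. Qed.

Section GaussianMarkov.
Context {disp : measure_display} {T : measurableType disp} {R : realType}.
Variables (P : probability T R) (d N : nat).

Lemma indep_events_sub (F F' G G' : set (set T)) : F `<=` F' -> G `<=` G' ->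
  indep_events P F' G' -> indep_events P F G.
Proof. by move=> FF' GG' FG A B /FF' FA /GG' GB; exact: FG. Qed.

(* [K = blockmx B] is a multiple of the precision matrix.  With [Y = K x],
   [Y_past], [Y_future] and [x_k] are pairwise uncorrelated, and the past is a
   linear function of [Y_past] and [x_k]: [Y_past] does not involve the future. *)
Lemma markov_of_tridiag (x : nat -> T -> 'cV[R]_d) (S : 'M[R]_(\sum_(k < N.+1) d))
    (B : 'I_N.+1 -> 'I_N.+1 -> 'M[R]_d) (l : R) :
  gauss_vec P (stack N x) S -> posdefmx (blockmx B) ->
  blockmx B *m S = l%:M ->
  (forall a b : 'I_N.+1, (a.+1 < b)%N -> B a b = 0) ->
  markov_seq P N x.
Proof.
move=> XS Kp KS B0 k kN; set K := blockmx B in Kp KS.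
have [Kt _] := Kp; have [_ XSc] := XS.
have B0' (a b : 'I_N.+1) : (a.+1 < b)%N -> B b a = 0.
  move=> ab; have : K^T = K := Kt.
  rewrite tr_blockmx => /blockmx_inj/(_ b a) <-.
  by rewrite B0// trmx0.
pose p := blockmask (m := N.+1) d (fun i => (i < k)%N) : 'M[R]__.
pose c := blockmask (m := N.+1) d (fun i => i == k :> nat) : 'M[R]__.
pose f := blockmask (m := N.+1) d (fun i => (k < i)%N) : 'M[R]__.
have pcf : p + c + f = 1%:M.
  by apply: blockmask_sum3 => i; case: ltngtP.
have pKf : p *m K *m f = 0.
  by apply: blockmask_comp0 => i j ik kj; apply: B0; exact: leq_ltn_trans ik kj.
have fKp : f *m K *m p = 0.
  by apply: blockmask_comp0 => i j ki jk; apply: B0'; exact: leq_ltn_trans jk ki.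
have pc : p *m c = 0.
  rewrite blockmaskM -[RHS]blockmask0; apply: eq_blockmx => i j /=.
  by rewrite (_ : _ && _ = false)//; case: ltngtP.
have fc : f *m c = 0.
  rewrite blockmaskM -[RHS]blockmask0; apply: eq_blockmx => i j /=.
  by rewrite (_ : _ && _ = false)//; case: ltngtP.
pose X := stack N x.
pose U := sigma_vec (fun w => (p *m K) *m X w).
pose V := sigma_vec (fun w => (f *m K) *m X w).
pose H := sigma_seq x [set k].
have mX s : measurable_fun setT (fun w => X w s 0).
  have [_ [+ _]] := XSc (delta_mx 0 s); congr measurable_fun.
  by apply/funext => w; rewrite -rowE mxE.
have mMX q (M : 'M[R]_(q, _)) i : measurable_fun setT (fun w => (M *m X w) i 0).
  under eq_fun do rewrite mxE.
  by apply: measurable_sum => j; apply: measurable_funM.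
have sU : sub_sigma_algebra_of U by apply: sigma_vec_measurable; exact: mMX.
have sV : sub_sigma_algebra_of V by apply: sigma_vec_measurable; exact: mMX.
have xX j i : (j <= N)%N -> (fun w => x j w i 0) =
    (fun w => X w (tagnat.Rank (p_ := fun=> d) (inord j : 'I_N.+1) i) 0).
  by move=> jN; apply/funext => w;
    rewrite [RHS](blockcol_Rank (fun k : 'I_N.+1 => x k w)) inordK.
have sH : sub_sigma_algebra_of H.
  split; first exact: smallest_sigma_algebra.
  apply: smallest_sub; first exact: sigma_algebra_measurable.
  by move=> _ [_ /= -> [i _ [C mC <-]]]; rewrite (xX k i kN); exact: mX.
have maskX J w : blockmask d J *m X w = blockcol (fun i : 'I_N.+1 =>
  if J i then x i w else 0).
  rewrite [LHS]blockdiag_col; apply: eq_blockcol => i.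
  by case: ifP; rewrite ?mul1mx ?mul0mx.
(* Masking replaces the other blocks by the constant 0, so [c *m X] generates the same sigma-algebra
   as the state at time [k]. *)
have Hc : sigma_vec (fun w => c *m X w) `<=` H.
  rewrite -[H](sigma_algebra_id sH.1).
  apply: sigma_vec_sub => s; under eq_fun do rewrite maskX blockcolE.
  case: eqP => [ks|_]; last by under eq_fun do rewrite mxE; exact: measurable_cst.
  apply: (@measurable_wrt_sigma_seq _ _ _ _ _ [set k]) => //.
have Jx (J : pred 'I_N.+1) j i : (j <= N)%N -> J (inord j : 'I_N.+1) ->
    (fun w => x j w i 0) =
    (fun w => (blockmask d J *m X w)
      (tagnat.Rank (p_ := fun=> d) (inord j : 'I_N.+1) i) 0).
  by move=> jN Jj; apply/funext => w; rewrite maskX blockcol_Rank Jj inordK.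
have cH : H `<=` sigma_vec (fun w => c *m X w).
  rewrite -[sigma_vec _](sigma_algebra_id (@smallest_sigma_algebra _ setT _)).
  apply: sigma_seq_sub => _ i /= ->.
  rewrite (Jx (fun i => i == k :> nat)) ?inordK//.
  exact: measurable_wrt_sigma_vec (@sub_sigma_algebra _ _ _) _.
(* The hypothesis says that [q *m K] couples [q] only with itself and [c], so [q *m K *m X] is
   [q *m K *m q *m X] plus a linear function of the state at time [k]; [W] undoes the compression
   [q *m K *m q]. *)
have recover (J : pred 'I_N.+1) (q := blockmask d J : 'M[R]__)
  (G : set (set T)) : q *m K *m (1%:M - q - c) = 0 ->
    sigma_vec (fun w => (q *m K) *m X w) `<=` G -> H `<=` G ->
    forall i, measurable_wrt G (fun w => (q *m X w) i 0).
  move=> qK UG HG.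
  have [W qW] := posdefmx_compression Kp (blockmask_sym d J) (blockmask_idem d J).
  rewrite -/q in qW.
  have qE w : q *m X w = W *m ((q *m K) *m X w) - (W *m (q *m K)) *m (c *m X w).
    rewrite [in LHS]qW -!mulmxA -mulmxBr; congr (_ *m _).
    rewrite !mulmxA -!mulmxBl; congr (_ *m _).
    move: qK; rewrite !mulmxBr mulmx1 => /eqP; rewrite subr_eq0 => /eqP <-.
    by rewrite opprB addrC subrK.
  have subE (A A' : 'cV[R]_(\sum_(k < N.+1) d)) i : (A - A') i 0 = A i 0 - A' i 0.
    by rewrite !mxE.
  move=> i; under eq_fun do rewrite qE subE.
  apply: measurable_funB.
    apply: measurable_wrt_mulmx; apply: measurable_wrt_sigma_vec.
    by apply: subset_trans UG _; exact: sub_sigma_algebra.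
  apply: measurable_wrt_mulmx; apply: measurable_wrt_sigma_vec.
  by apply: subset_trans Hc _; apply: subset_trans HG _; exact: sub_sigma_algebra.
apply: (cond_indep_join sU sV sH).
(* The cross term is [p *m K *m S *m K *m f], which the scalar product [K *m S] reduces to a
   multiple of [p *m K *m f]. *)
- apply: gauss_vec_indep XS _.
  rewrite trmx_mul Kt blockmask_sym -(mulmxA p) KS mul_mx_scalar.
  by rewrite -scalemxAl mulmxA pKf scaler0.
(* Independence from the join is more than independence from each part, so both blocks are stacked
   into one vector. Its cross term with the state at time [k] consists of multiples of [p *m c] and
   [f *m c]. *)
- pose A := col_mx (p *m K) (f *m K).
  apply: (@indep_events_sub _ (sigma_vec (fun w => A *m X w)) _
    (sigma_vec (fun w => c *m X w))) => //.
    apply: smallest_sub; first exact: smallest_sigma_algebra.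
    rewrite -[sigma_vec _](sigma_algebra_id (@smallest_sigma_algebra _ setT _)).
    move=> D [|]; apply: sigma_vec_sub => i.
      rewrite (_ : (fun w => _) = fun w => (A *m X w) (lshift _ i) 0).
        exact: measurable_wrt_sigma_vec (@sub_sigma_algebra _ _ _) _.
      by apply/funext => w; rewrite mul_col_mx col_mxEu.
    rewrite (_ : (fun w => _) = fun w => (A *m X w) (rshift _ i) 0).
      exact: measurable_wrt_sigma_vec (@sub_sigma_algebra _ _ _) _.
    by apply/funext => w; rewrite mul_col_mx col_mxEd.
  apply: gauss_vec_indep XS _.
  rewrite blockmask_sym /A !mul_col_mx -(mulmxA p) -(mulmxA f) KS !mul_mx_scalar.
  by rewrite -!scalemxAl pc fc !scaler0 col_mx0.
- apply: sigma_seq_sub => j i /= jk.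
  rewrite (Jx (fun i => (i < k)%N)) ?inordK// ?(leq_trans (ltnW jk))//.
    apply: recover; [|exact: subsetUl|exact: subsetUr].
    by rewrite -pcf addrAC -/p addrC !addrA addNr add0r addrC addKr pKf.
  by rewrite ltnS (leq_trans (ltnW jk)).
- apply: sigma_seq_sub => j i /= /andP[kj jN].
  rewrite (Jx (fun i => (k < i)%N)) ?inordK//.
  apply: recover; [|exact: subsetUl|exact: subsetUr].
  by rewrite -pcf -/f addrK addrK fKp.
Qed.

End GaussianMarkov.

(** * Sequences governed by a CML model *)

Section CMLSequences.
Context {R : realType} (d N : nat).
Variables (Gp Gl G : nat -> 'M[R]_d) (G0N G0 GN : 'M[R]_d).
Hypothesis N0 : (0 < N)%N.
Hypothesis noise_pos : forall i, (i <= N)%N -> posdefmx (noise_cov N G G0 GN i).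

Let L := cml_mx N Gp Gl G0N.
Let Lambda := blockdiag (fun i : 'I_N.+1 => noise_cov N G G0 GN i).
Let Sigma := invmx L *m (stdvar^-1 *: Lambda) *m (invmx L)^T.
Let K := cml_precision N Gp Gl G0N (noise_cov N G G0 GN).

Lemma noise_posdef : posdefmx Lambda.
Proof. by apply: posdefmx_blockdiag => i; exact/noise_pos/leq_ord. Qed.

Lemma blockdiag_invmx : invmx Lambda = blockdiag (fun i : 'I_N.+1 =>
    invmx (noise_cov N G G0 GN i)).
Proof.
have Lu := posdefmx_unit noise_posdef.
apply: (can_inj (mulKmx Lu)); rewrite mulmxV//; apply: mulmx_ext => v.
rewrite mul1mx -(blockcolK v) -mulmxA !blockdiag_col; apply: eq_blockcol => i.
by rewrite mulmxA mulmxV ?mul1mx//; apply/posdefmx_unit/noise_pos; rewrite -ltnS.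
Qed.

Lemma cml_precision_posdef : posdefmx K.
Proof.
rewrite /K /cml_precision -blockdiag_invmx; apply: posdefmx_congr.
  exact/posdefmx_inv/noise_posdef.
exact: cml_mx_unit.
Qed.

Lemma cml_precision_mul : K *m Sigma = (stdvar^-1)%:M.
Proof.
have Lu : L \in unitmx by exact: cml_mx_unit.
rewrite /K /cml_precision -blockdiag_invmx /Sigma -/L -!mulmxA (mulmxA L)
  mulmxV// mul1mx.
rewrite -scalemxAl -!scalemxAr (mulmxA (invmx Lambda)) mulVmx ?mul1mx; last first.
  exact/posdefmx_unit/noise_posdef.
by rewrite -trmx_mul mulVmx// trmx1 scalemx1.
Qed.

Context {disp : measure_display} {T : measurableType disp} (P : probability T R).

Lemma covmx_stack (x : nat -> T -> 'cV[R]_d) :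
  covmx P (stack N x) (stack N x) =
  blockmx (fun i j : 'I_N.+1 => covmx P (x i) (x j)).
Proof.
apply/matrixP => s t; rewrite covmxE [RHS]mxE covmxE;
  congr (fine (covariance P _ _));
  by apply/funext => w; rewrite mxE.
Qed.

Lemma cml_mx_governed (x e : nat -> T -> 'cV[R]_d) w :
  L *m stack N x w = stack N e w <->
  forall k, (k <= N)%N -> x k w = cml_mean N Gp Gl G0N (x ^~ w) k + e k w.
Proof.
have -> : L *m stack N x w = _ := cml_mx_col N Gp Gl G0N (x ^~ w).
rewrite -[stack N e w]/(blockcol (fun k : 'I_N.+1 => e k w));
  split => [/blockcol_inj xe k kN|xe].
  by have := xe (inord k); rewrite inordK// => <-; rewrite addrC subrK.
by apply: eq_blockcol => k; rewrite (xe k (leq_ord k)) addrAC subrr add0r.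
Qed.

(** A governed sequence is [invmx L] applied to its noise, so the parameters determine its law on
    any probability space. *)
Lemma gauss_vec_governed (x : nat -> T -> 'cV[R]_d) :
  CML_governed P N Gp Gl G G0N G0 GN x -> gauss_vec P (stack N x) Sigma.
Proof.
move=> [e [[ge ze we _] ce xe xN x0]].
have Ee : gauss_vec P (stack N e) (stdvar^-1 *: Lambda).
  have zE : zero_mean P (stack N e).
    move=> s; have := ze (tagnat.sig1 s);
      rewrite -ltnS => /(_ (ltn_ord _) (tagnat.sig2 s)) <-.
    by congr expectation; apply/funext => w; rewrite mxE.
  have := jointly_gaussian_gauss_vec ge zE; rewrite covmx_stack.
  rewrite (_ : blockmx _ = Lambda)//; apply: eq_blockmx => i j.
  have iN : (i <= N)%N by rewrite -ltnS.
  have jN : (j <= N)%N by rewrite -ltnS.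
  by case: eqP => [->|/eqP ij]; [rewrite ce|rewrite we].
have := gauss_vec_mulmx (invmx L) Ee.
rewrite (_ : (fun w => _) = stack N x)//; apply/funext => w.
have Lu : L \in unitmx by exact: cml_mx_unit.
apply: (can_inj (mulKmx Lu)); rewrite mulKVmx//; apply/esym/cml_mx_governed => k.
rewrite /cml_mean; case: ifPn => [k0N _|]; first exact: xe.
rewrite negb_and -leqNgt leqn0 -leqNgt => /orP[/eqP->|Nk] kN;
  first by rewrite eqxx x0.
have -> : k = N by apply/eqP; rewrite eqn_leq kN.
by rewrite gtn_eqF// xN add0r.
Qed.

Lemma zm_nonsingular_governed (x : nat -> T -> 'cV[R]_d) :
  CML_governed P N Gp Gl G G0N G0 GN x -> zm_nonsingular_gaussian P N x.
Proof.
move=> /gauss_vec_governed XS; split.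
- exact: gauss_vec_jointly XS.
- move=> k kN i; have := gauss_vec_zero_mean XS
    (tagnat.Rank (p_ := fun=> d) (inord k : 'I_N.+1) i) => <-.
  congr expectation; apply/funext => w.
  by rewrite (blockcol_Rank (fun k : 'I_N.+1 => x k w)) inordK.
- rewrite (covmx_gauss_vec_self XS);
    have := cml_precision_mul => /(congr1 (fun M => stdvar *: M)).
  rewrite scalemxAr -[in RHS]scalemx1 scalerA divff ?scale1r;
    last by rewrite gt_eqF// stdvar_gt0.
  by move=> /mulmx1_unit[].
Qed.

End CMLSequences.

Lemma governed_exists (R : realType) (d N : nat) (Gp Gl G : nat -> 'M[R]_d)
    (G0N G0 GN : 'M[R]_d) :
  (0 < N)%N -> (forall i, (i <= N)%N -> posdefmx (noise_cov N G G0 GN i)) ->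
  exists (disp : measure_display) (T : measurableType disp)
    (P : probability T R) (x : nat -> T -> 'cV[R]_d),
    CML_governed P N Gp Gl G G0N G0 GN x.
Proof.
move=> N0 noise_pos.
pose Lambda := blockdiag (fun i : 'I_N.+1 => noise_cov N G G0 GN i).
(* The division by [stdvar] follows the normalization of [gauss_vec], so that the true covariance of
   [Z] is [Lambda]. *)
have Lp : posdefmx (stdvar^-1 *: Lambda : 'M[R]__).
  have [Lt Lp] := noise_posdef noise_pos; split; first by rewrite linearZ/= Lt.
  move=> v v0; rewrite -scalemxAr -scalemxAl mxE mulr_gt0 ?invr_gt0 ?stdvar_gt0//.
  exact: Lp.
have [disp [T [P [Z ZL]]]] := gauss_vec_exists Lp.
pose L := cml_mx N Gp Gl G0N.
have Lu : L \in unitmx by exact: cml_mx_unit.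
pose e (k : nat) w : 'cV[R]_d := submxcol (Z w) (inord k : 'I_N.+1).
pose x (k : nat) w : 'cV[R]_d := submxcol (invmx L *m Z w) (inord k : 'I_N.+1).
have stackK (y : T -> 'cV[R]_(\sum_(k < N.+1) d)) w :
    stack N (fun k w => submxcol (y w) (inord k : 'I_N.+1)) w = y w.
  rewrite -[RHS]blockcolK; apply: eq_blockcol => i; by rewrite inord_val.
have stacke : stack N e = Z by apply/funext => w; exact: stackK.
have cove (j k : 'I_N.+1) : covmx P (e j) (e k) = if j == k then noise_cov N G
  G0 GN j else 0.
  have := covmx_gauss_vec_self ZL; rewrite scalerA divff ?scale1r;
    last by rewrite gt_eqF// stdvar_gt0.
  rewrite -stacke covmx_stack /Lambda /blockdiag => /blockmx_inj ->.
  by case: eqP.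
have cove' j k : (j <= N)%N -> (k <= N)%N ->
    covmx P (e j) (e k) = if j == k then noise_cov N G G0 GN j else 0.
  move=> jN kN; have := cove (inord j) (inord k).
  by rewrite -val_eqE /= !inordK.
exists disp, T, P, x, e; have gov w := (cml_mx_governed N Gp Gl G0N x e w).1.
have {}gov w k : (k <= N)%N -> x k w = cml_mean N Gp Gl G0N (x ^~ w) k + e k w.
  by apply: gov; rewrite stackK stacke mulKVmx.
split.
- split.
  + by rewrite stacke; exact: gauss_vec_jointly ZL.
  + move=> k kN i; have := gauss_vec_zero_mean ZL
      (tagnat.Rank (p_ := fun=> d) (inord k : 'I_N.+1) i) => <-.
    by congr expectation; apply/funext => w; rewrite mxE.
  + by move=> j k jN kN jk; rewrite cove'// (negbTE jk).
  + by move=> k kN; rewrite cove'// eqxx; exact/posdefmx_unit/noise_pos.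
- by move=> k kN; rewrite cove'// eqxx.
- by move=> k w k0N; rewrite gov /cml_mean ?k0N//; case/andP: k0N => _ /ltnW.
- by move=> w; rewrite gov// /cml_mean ltnn andbF gtn_eqF// add0r.
- by move=> w; rewrite gov// /cml_mean ltnn.
Qed.

(** The existence clause keeps the universal clause from being vacuous; the latter covers every
    realization of the model, on every probability space. *)
Theorem lemma3p1 (R : realType) (d N : nat) (hN : (0 < N)%N)
    (Gp Gl G : nat -> 'M[R]_d)
    (hmodel : reciprocal_CML_model N Gp Gl G) :
  exists G0N G0 GN : 'M[R]_d,
    [/\ posdefmx G0, posdefmx GN,
        exists (disp : measure_display) (T : measurableType disp)
               (P : probability T R) (x : nat -> T -> 'cV[R]_d),
          CML_governed P N Gp Gl G G0N G0 GN x
      & forall (disp : measure_display) (T : measurableType disp)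
               (P : probability T R) (x : nat -> T -> 'cV[R]_d),
          CML_governed P N Gp Gl G G0N G0 GN x ->
          zm_nonsingular_gaussian P N x /\ markov_seq P N x].
Proof.
have [Gpos Grec] := hmodel.
(* With identity covariance at time 0, this value is the reciprocity recursion continued to index 0.
   For [N = 1] its value is immaterial: no two times are nonadjacent. *)
pose G0N := (Gp 1%N)^T *m invmx (G 1%N) *m Gl 1%N.
exists G0N, 1%:M, 1%:M; set D := noise_cov N G 1%:M 1%:M.
have Dpos i : (i <= N)%N -> posdefmx (D i).
  move=> iN; rewrite /D /noise_cov; case: eqP => [_|/eqP i0];
    first exact: posdefmx1.
  case: eqP => [_|/eqP iN']; first exact: posdefmx1.
  by apply: Gpos; rewrite lt0n i0 ltn_neqAle iN'.
have tridiag a : (a.+1 < N)%N -> invmx (D a) *m (if (0 < a)%N then Gl a else G0N) =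
    (Gp a.+1)^T *m invmx (D a.+1) *m Gl a.+1.
  move=> aN; rewrite /D /noise_cov /= (ltn_eqF aN) (ltn_eqF (ltnW aN)).
  case: a aN => [|a] aN /=; first by rewrite invmx1 mul1mx.
  exact: Grec.
split; [exact: posdefmx1|exact: posdefmx1|exact: governed_exists|].
move=> disp T P x xG; split; first exact: zm_nonsingular_governed xG.
have XS := gauss_vec_governed hN xG.
have := cml_precision_posdef Gp Gl G0N hN Dpos.
have := cml_precision_mul Gp Gl G0N hN Dpos.
rewrite cml_precisionE => KS Kpos.
exact: markov_of_tridiag XS Kpos KS (cml_precision_tridiag tridiag).
Qed.
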